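(* Let $\mathfrak g(\mathbb R)$ be a real form of a complex simple Lie algebra $\mathfrak g(\mathbb C)$. Every weak equivalence class of Manin triples $(\mathfrak g(\mathbb R),W(\mathbb R),\mathfrak g(\mathbb C))$ consists of a finite number of gauge equivalence classes of Manin triples.
   Context: A Manin triple $(\mathfrak g_1,\mathfrak g_2,\mathfrak d)$ over $\mathbb R$ consists of a finite-dimensional real Lie algebra $\mathfrak d$ with a symmetric nondegenerate $\mathrm{ad}$-invariant bilinear form and Lie subalgebras $\mathfrak g_1,\mathfrak g_2$ that are maximal isotropic with $\mathfrak d=\mathfrak g_1\oplus\mathfrak g_2$ as a vector space. Here $\mathfrak d=\mathfrak g(\mathbb C)$ is regarded as a real Lie algebra containing $\mathfrak g(\mathbb R)$, with the form $2i\,\mathrm{Im}\,K(x,y)$ (equivalently, up to a constant factor, $\mathrm{Im}\,K$), where $K$ is the Killing form of $\mathfrak g(\mathbb C)$. Let $G(\mathbb C)$ be the adjoint group of $\mathfrak g(\mathbb C)$. $(\mathfrak g(\mathbb R),W,\mathfrak g(\mathbb C))$ and $(\mathfrak g(\mathbb R),W',\mathfrak g(\mathbb C))$ are weak equivalent if $W'=\mathrm{Ad}_a(W)$ for some $a\in G(\mathbb C)$; gauge equivalent if in addition $a$ can be chosen with $\mathrm{Ad}_a(\mathfrak g(\mathbb R))=\mathfrak g(\mathbb R)$. *)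

(* Defs.v *)
From HB Require Import structures.
From mathcomp Require Import all_boot all_order all_algebra.
From mathcomp Require Import sesquilinear complex.
From mathcomp Require Import all_classical all_reals all_analysis.

Set Implicit Arguments.
Unset Strict Implicit.
Unset Printing Implicit Defensive.

Import Order.TTheory GRing.Theory Num.Theory.
Import numFieldNormedType.Exports VectorInternalTheory.

Local Open Scope classical_set_scope.
Local Open Scope ring_scope.
Local Open Scope complex_scope.

HB.mixin Record Vector_isLieAlgebra (F : fieldType) L of Vector F L := {
  lie : L -> L -> L;
  lie_bilinear : bilinear_for *:%R *:%R lie;
  liexx : forall x, lie x x = 0;
  lie_jacobi : forall x y z,
    lie x (lie y z) + lie y (lie z x) + lie z (lie x y) = 0
}.

#[short(type="lieAlgType")]
HB.structure Definition LieAlgebra (F : fieldType) :=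
  { L of Vector_isLieAlgebra F L & Vector F L }.

Section LieAlgebraTheory.
Context {F : fieldType} {L : lieAlgType F}.
Implicit Types (x y : L) (U I : {vspace L}).

Definition ad x : 'End(L) := linfun (lie x).

Lemma adE x y : ad x y = lie x y.
Proof.
pose adx := HB.pack_for {linear L -> L} (lie x)
  (GRing.isLinear.Build F L L *:%R (lie x) ((lie_bilinear (s := L)).2 x)).
exact: (lfunE adx).
Qed.

Definition subalgebra U := forall x y, x \in U -> y \in U -> lie x y \in U.

Definition ideal I := forall x y, y \in I -> lie x y \in I.

Definition simple_lie :=
  (exists x y, lie x y <> 0) /\
  (forall I, ideal I -> I = 0%VS \/ I = fullv).

Definition lftrace (f : 'End(L)) : F :=
  \sum_(i < \dim {:L}) coord (vbasis {:L}) i (f (vbasis {:L})`_i).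

Definition killing x y : F := lftrace (ad x \o ad y)%VF.

End LieAlgebraTheory.

Arguments simple_lie {F} L.

(* The series is summed in coordinates ('End(V) is itself a vectType).  It
   always converges over R and R[i], the only fields this is meant for. *)
Definition lfun_exp (F : numFieldType) (V : vectType F) (f : 'End(V)) :
    'End(V) :=
  r2v (lim ((fun n => v2r
    (\sum_(k < n) (k`!%:R)^-1 *: iter k (comp_lfun f) \1%VF)) @ \oo)).

(* The adjoint group, as a subgroup of GL(L): the connected Lie subgroup with
   Lie algebra ad L, i.e. the subgroup generated by the exp (ad x).
   All its elements are bijective, so ^-1 is the genuine inverse. *)
Inductive adjoint_group (F : numFieldType) (L : lieAlgType F) :
    'End(L) -> Prop :=
| adjoint_exp x : adjoint_group (lfun_exp (ad x))
| adjoint_one : adjoint_group \1%VF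
| adjoint_mul a b :
    adjoint_group a -> adjoint_group b -> adjoint_group (a \o b)%VF
| adjoint_inv a : adjoint_group a -> adjoint_group (a^-1)%VF.

Definition direct_decomposition (F : fieldType) (V : vectType F)
    (U1 U2 : {vspace V}) :=
  directv (U1 + U2) /\ (U1 + U2)%VS = fullv.

Section Manin.
Context {F : fieldType} {d : lieAlgType F} (B : d -> d -> F).
Implicit Type U : {vspace d}.

Definition isotropic U := forall x y, x \in U -> y \in U -> B x y = 0.

Definition maximal_isotropic U :=
  isotropic U /\ forall U', isotropic U' -> (U <= U')%VS -> U' = U.

Record manin_triple (g1 g2 : {vspace d}) : Prop := {
  manin_bilinear : bilinear_for *%R *%R B;
  manin_sym : forall x y, B x y = B y x;
  manin_nondeg : forall x, (forall y, B x y = 0) -> x = 0;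
  manin_invariant : forall x y z, B (lie x y) z = B x (lie y z);
  manin_subalg1 : subalgebra g1;
  manin_subalg2 : subalgebra g2;
  manin_max1 : maximal_isotropic g1;
  manin_max2 : maximal_isotropic g2;
  manin_direct : direct_decomposition g1 g2
}.

End Manin.

Definition realification (R : rcfType) (g : Type) : Type := g.

Section Realification.
Context {R : rcfType}.

Section Lmod.
Variable g : lmodType R[i].
Local Notation gr := (realification R g).

HB.instance Definition _ := GRing.Zmodule.on gr.

Definition real_scale (r : R) (x : gr) : gr := r%:C *: (x : g).

Fact real_scaleA r s x : real_scale r (real_scale s x) = real_scale (r * s) x.
Proof. by rewrite /real_scale scalerA rmorphM. Qed.

Fact real_scale1 : left_id 1 real_scale.
Proof. by move=> x; rewrite /real_scale rmorph1 scale1r. Qed.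

Fact real_scaleDr : right_distributive real_scale +%R.
Proof. by move=> r x y; rewrite /real_scale scalerDr. Qed.

Fact real_scaleDl x : {morph real_scale^~ x : r s / r + s}.
Proof. by move=> r s; rewrite /real_scale rmorphD scalerDl. Qed.

HB.instance Definition _ := GRing.Zmodule_isLmodule.Build R gr
  real_scaleA real_scale1 real_scaleDr real_scaleDl.

Lemma real_scaleE (r : R) (x : gr) : r *: x = (r%:C *: (x : g)) :> g.
Proof. by []. Qed.

End Lmod.

Section Vect.
Variable g : vectType R[i].
Local Notation gr := (realification R g).
Local Notation n := (dim g).

Definition real_v2r (x : gr) : 'rV[R]_(n + n) :=
  row_mx (map_mx (@complex.Re R) (v2r (x : g)))
         (map_mx (@complex.Im R) (v2r (x : g))).

Definition real_r2v (v : 'rV[R]_(n + n)) : gr :=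
  r2v (\row_j (lsubmx v 0 j +i* rsubmx v 0 j)) : g.

Fact real_v2r_vect : Vector.axiom (n + n) gr.
Proof.
exists real_v2r.
  move=> r x y; rewrite /real_v2r scale_row_mx add_row_mx.
  have -> : v2r (r *: x + y : g) = r%:C *: v2r (x : g) + v2r (y : g).
    exact: linearP.
  congr row_mx; apply/rowP => j; rewrite !mxE.
    by case: (v2r (x : g) 0 j) (v2r (y : g) 0 j) => [a b] [c e] /=;
      rewrite mul0r subr0.
  by case: (v2r (x : g) 0 j) (v2r (y : g) 0 j) => [a b] [c e] /=;
    rewrite mul0r addr0.
exists real_r2v => [x|v].
  rewrite /real_r2v /real_v2r row_mxKl row_mxKr -[RHS](@v2rK _ g).
  by congr r2v; apply/rowP => j; rewrite !mxE; case: (v2r _ 0 j).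
rewrite /real_r2v /real_v2r r2vK -[RHS]hsubmxK.
by congr row_mx; apply/rowP => j; rewrite !mxE.
Qed.

HB.instance Definition _ :=
  Lmodule_hasFinDim.Build R gr real_v2r_vect.

End Vect.

Section Lie.
Variable g : lieAlgType R[i].
Local Notation gr := (realification R g).

Definition real_lie (x y : gr) : gr := lie (x : g) (y : g).

Fact real_lie_bilinear : bilinear_for *:%R *:%R real_lie.
Proof.
by split=> u r x y; [apply: ((lie_bilinear (s := g)).1 u r%:C) |
  apply: ((lie_bilinear (s := g)).2 u r%:C)].
Qed.

HB.instance Definition _ := Vector_isLieAlgebra.Build R gr
  real_lie_bilinear (@liexx _ g) (@lie_jacobi _ g).

End Lie.
End Realification.

Section RealForms.
Context {R : realType} {g : lieAlgType R[i]}.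
Local Notation gr := (realification R g).
Implicit Types gR W : {vspace gr}.

Definition real_lfun (f : 'End(g)) : 'End(gr) := linfun (f : gr -> gr).

Lemma real_lfunE (f : 'End(g)) (x : gr) : real_lfun f x = f x.
Proof.
pose fr := HB.pack_for {linear gr -> gr} (f : gr -> gr)
  (GRing.isLinear.Build R gr gr *:%R (f : gr -> gr)
     (fun r => linearP f r%:C)).
exact: (lfunE fr).
Qed.

Definition mul_i : 'End(gr) := real_lfun ('i *: \1%VF).

Definition real_form gR :=
  subalgebra gR /\ direct_decomposition gR (mul_i @: gR)%VS.

(* The imaginary-valued form 2i Im K, up to the constant 2i. *)
Definition im_killing (x y : gr) : R := complex.Im (killing (x : g) (y : g)).

Definition real_manin_triple gR W := manin_triple im_killing gR W.

Definition weak_equiv W W' :=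
  exists2 a : 'End(g), adjoint_group a & W' = (real_lfun a @: W)%VS.

Definition gauge_equiv gR W W' :=
  exists a : 'End(g), [/\ adjoint_group a, W' = (real_lfun a @: W)%VS
    & (real_lfun a @: gR)%VS = gR].

(* A Manin triple (gR, W, g) with gR fixed is identified with W. *)
Definition is_weak_class gR (A : set {vspace gr}) :=
  exists2 W, real_manin_triple gR W &
    A = [set W' | real_manin_triple gR W' /\ weak_equiv W W'].

Definition is_gauge_class gR (A : set {vspace gr}) :=
  exists2 W, real_manin_triple gR W &
    A = [set W' | real_manin_triple gR W' /\ gauge_equiv gR W W'].

End RealForms.

(* Main.v *)
(* The real points a of Aut(g(C)) with g(R) + a(W) = g(C) form a set
   X = {h = 0, f <> 0} for real polynomials h and f. Near any a in X, every
   b in X has the form exp(ad x) exp(ad y) a with x in g(R) and y in a(W): by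
   transversality and nondegeneracy of the Killing form, the map
   (x, y) |-> exp(ad x) exp(ad y) covers a neighbourhood of 1 in Aut(g(C)).
   Since exp(ad x) stabilizes g(R) and exp(ad y) stabilizes a(W), the gauge
   equivalence classes cut X into relatively open pieces.

   There are finitely many such pieces: choose a point in each of m of them,
   and consider f^2 - M h^2 - delta (x_1^(2D) + ... + x_n^(2D)) with M large
   and delta small. It has a local maximum near each of the m pieces. At its
   critical points x_i^(2D-1) is a polynomial of smaller degree, so the
   monomials with all exponents < 2D-1 span the functions on any finite set of
   critical points, and m <= (2D-1)^n. *)

From HB Require Import structures.
Require Import Defs.
From mathcomp Require Import all_boot all_order all_algebra finmap.
From mathcomp Require Import complex.
From mathcomp Require Import all_classical all_reals all_analysis.
From mathcomp Require Import ring lra.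

Set Implicit Arguments.
Unset Strict Implicit.
Unset Printing Implicit Defensive.

Import Order.TTheory GRing.Theory Num.Theory.
Import numFieldNormedType.Exports VectorInternalTheory.

Local Open Scope classical_set_scope.
Local Open Scope ring_scope.

(** * Polynomial functions *)

(** The covering claim is the hard point: homomorphisms do not form an open subset of ['End(g)], so
    an inverse function theorem there says nothing about them. They are compared instead through a
    linear map [P] from ['End(g)] onto [g], the orthogonal projection to [ad g] for the trace form,
    which exists because the Killing form is nondegenerate. Products of two exponentials attain
    every value near [P 1], since [P] is a left inverse of [ad] and the two subalgebras span; and a
    homomorphism near the identity is determined by its value under [P]. The second fact uses only
    the homomorphism identity and cyclicity of the trace, in place of the Lie group structure of the
    automorphism group. In the counting, the even powers have larger degree than the rest and act
    twice: they make superlevel sets compact, so that maxima exist, and they leave a pure power of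
    one variable in each critical equation. *)

Section PolynomialFunctions.
Variables (R : realType) (n : nat).
Local Notation V := 'rV[R]_n.

(** The index is only an upper bound for the degree. An inductive predicate on functions lets
    continuity, growth, derivatives and division be proved by induction on the construction of
    [f]. *)
Inductive polfun : nat -> (V -> R) -> Prop :=
| polfun_cst c : polfun 0 (fun=> c)
| polfun_coord i : polfun 1 (fun x => x 0 i)
| polfun_add d f g : polfun d f -> polfun d g -> polfun d (fun x => f x + g x)
| polfun_mul d e f g :
    polfun d f -> polfun e g -> polfun (d + e) (fun x => f x * g x)
| polfun_le d e f : (d <= e)%N -> polfun d f -> polfun e f.

Lemma polfun_const d c : polfun d (fun=> c).
Proof. exact: polfun_le (polfun_cst c). Qed.

Lemma polfunZ d c f : polfun d f -> polfun d (fun x => c * f x).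
Proof. exact: (@polfun_mul 0 d (fun=> c)) (polfun_cst c). Qed.

Lemma polfunB d f g :
  polfun d f -> polfun d g -> polfun d (fun x => f x - g x).
Proof.
move=> pf pg; have -> : (fun x => f x - g x) = (fun x => f x + -1 * g x).
  by apply/funext => x; rewrite mulN1r.
by apply: polfun_add => //; exact: polfunZ.
Qed.

Lemma polfun_sum (I : Type) (r : seq I) (P : pred I) d (F : I -> V -> R) :
  (forall i, P i -> polfun d (F i)) -> polfun d (fun x => \sum_(i <- r | P i) F i x).
Proof.
move=> pF; elim: r => [|i r IHr].
  have -> : (fun x : V => \sum_(i <- [::] | P i) F i x) = fun=> 0.
    by apply/funext => x; rewrite big_nil.
  exact: polfun_const.
have -> : (fun x => \sum_(j <- i :: r | P j) F j x)
    = (fun x => (if P i then F i x else 0) + \sum_(j <- r | P j) F j x).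
  by apply/funext => x; rewrite big_cons; case: ifP; rewrite ?add0r.
apply: polfun_add => //; case: (boolP (P i)) => [/pF//|_]; exact: polfun_const.
Qed.

Lemma polfun_prod (I : Type) (r : seq I) (d : I -> nat) (F : I -> V -> R) :
  (forall i, polfun (d i) (F i)) ->
  polfun (\sum_(i <- r) d i) (fun x => \prod_(i <- r) F i x).
Proof.
move=> pF; elim: r => [|i r IHr].
  have -> : (fun x : V => \prod_(i <- [::]) F i x) = fun=> 1.
    by apply/funext => x; rewrite big_nil.
  exact: polfun_const.
have -> : (fun x => \prod_(j <- i :: r) F j x)
    = (fun x => F i x * \prod_(j <- r) F j x).
  by apply/funext => x; rewrite big_cons.
by rewrite big_cons; exact: polfun_mul.
Qed.

Lemma polfunX d k f : polfun d f -> polfun (k * d) (fun x => f x ^+ k).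
Proof.
move=> pf; elim: k => [|k IHk]; first exact: polfun_const.
have -> : (fun x => f x ^+ k.+1) = (fun x => f x * f x ^+ k).
  by apply/funext => x; rewrite exprS.
by rewrite mulSn; exact: polfun_mul.
Qed.

Lemma polfun_det d m (A : V -> 'M[R]_m) :
  (forall i j, polfun d (fun x => A x i j)) -> polfun (m * d) (fun x => \det (A x)).
Proof.
move=> pA; apply: polfun_sum => s _; apply: polfunZ.
rewrite -[m in (m * d)%N]card_ord -sum_nat_const.
exact: (@polfun_prod _ _ (fun=> d)).
Qed.

Lemma polfun_continuous d f : polfun d f -> continuous f.
Proof.
elim=> {d f} [c|i|d f g _ cf _ cg|d e f g _ cf _ cg|//].
- exact: cst_continuous.
- exact: coord_continuous.
- by move=> x; apply: continuousD; [exact: cf|exact: cg].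
- by move=> x; apply: continuousM; [exact: cf|exact: cg].
Qed.

Lemma normr_coord_le m p (x : 'M[R]_(m, p)) i j : `|x i j| <= `|x|.
Proof.
rewrite [leRHS]mx_normrE; apply/bigmax_geP; right.
by exists (i, j).
Qed.

Lemma normr_mx_le m p (x : 'M[R]_(m, p)) e :
  0 <= e -> (forall i j, `|x i j| <= e) -> `|x| <= e.
Proof.
move=> e0 xe; rewrite [leLHS]mx_normrE; apply/bigmax_leP.
by split=> // -[i j] _; exact: xe.
Qed.

Lemma polfun_bounded d f :
  polfun d f -> exists2 C, 0 <= C & forall x, `|f x| <= C * (1 + `|x|) ^+ d.
Proof.
have ge1 (x : V) : 1 <= 1 + `|x| by rewrite lerDl.
have ge0 (x : V) : 0 <= 1 + `|x| by exact: le_trans (ge1 x).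
elim=> {d f} [c|i|d f g _ [C C0 fC] _ [D D0 gD]|d e f g _ [C C0 fC] _ [D D0 gD]
    |d e f de _ [C C0 fC]].
- by exists `|c| => // x; rewrite mulr1.
- exists 1 => // x; rewrite mul1r expr1.
  by apply: le_trans (normr_coord_le _ _ _) _; rewrite lerDr.
- exists (C + D) => [|x]; first exact: addr_ge0.
  by rewrite mulrDl (le_trans (ler_normD _ _))// lerD.
- exists (C * D) => [|x]; first exact: mulr_ge0.
  by rewrite normrM exprD mulrACA ler_pM.
- exists C => // x; apply: le_trans (fC x) _; rewrite ler_wpM2l//.
  exact: ler_weXn2l.
Qed.

(** The partial derivative is the linear coefficient of the restriction to a line, so it is found
    algebraically. The clause for [d = 0] serves the product rule: as [0.-1 = 0], the degree bound
    alone would not make [f * g'] drop a degree when [g] is constant. *)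
Lemma polfun_derivative i d f : polfun d f ->
  exists f', [/\ polfun d.-1 f', d = 0%N -> f' = fun=> 0 &
    forall x, exists2 p : {poly R},
      forall t, f (x + t *: delta_mx 0 i) = p.[t] & p`_1 = f' x].
Proof.
elim=> {d f} [c|j|d f g _ [f' [pf f0 fP]] _ [g' [pg g0 gP]]
    |d e f g pf0 [f' [pf f0 fP]] pg0 [g' [pg g0 gP]]|d e f de _ [f' [pf f0 fP]]].
- exists (fun=> 0); split=> // [|x]; first exact: polfun_const.
  by exists c%:P => [t|]; rewrite ?hornerC// coefC.
- exists (fun=> (j == i)%:R); split=> // [|x]; first exact: polfun_const.
  exists ((x 0 j)%:P + (j == i)%:R *: 'X) => [t|].
    by rewrite !hornerE !mxE eqxx/= mulrC.
  by rewrite coefD coefC coefZ coefX/= add0r mulr1.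
- exists (fun x => f' x + g' x); split=> [|d0|x]; first exact: polfun_add.
    by rewrite f0// g0//; apply/funext => x; rewrite addr0.
  have [p fp pf'] := fP x; have [q gq qg'] := gP x.
  exists (p + q) => [t|]; first by rewrite fp gq hornerD.
  by rewrite coefD pf' qg'.
- exists (fun x => f x * g' x + f' x * g x); split=> [|/eqP|x].
  + apply: polfun_add.
      case: e g0 pg {pg0 gP} => [g0 _|e _ pg].
        rewrite g0//; have -> : (fun x => f x * 0) = fun=> 0.
          by apply/funext => x; rewrite mulr0.
        exact: polfun_const.
      by rewrite addnS; exact: polfun_mul.
    case: d f0 pf {pf0 fP} => [f0 _|d _ pf].
      rewrite f0//; have -> : (fun x => 0 * g x) = fun=> 0.
        by apply/funext => x; rewrite mul0r.
      exact: polfun_const.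
    by rewrite addSn; exact: polfun_mul.
  + rewrite addn_eq0 => /andP[/eqP/f0-> /eqP/g0->].
    by apply/funext => x; rewrite mulr0 mul0r addr0.
  + have [p fp pf'] := fP x; have [q gq qg'] := gP x.
    exists (p * q) => [t|]; first by rewrite fp gq hornerM.
    have := fp 0; rewrite scale0r addr0 horner_coef0 => ->.
    have := gq 0; rewrite scale0r addr0 horner_coef0 => ->.
    by rewrite coefM big_ord_recl big_ord1/= subn0 pf' qg'.
- exists f'; split=> // [|e0]; last by apply: f0; apply/eqP; rewrite -leqn0 -e0.
  by apply: polfun_le pf; rewrite -!subn1 leq_sub2r.
Qed.

(** Splitting off one variable from each nonconstant term prepares inductions on the degree. A
    product is expanded as [c * g + \sum_i x_i F_i g], and [g] is decomposed in the first summand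
    only. The clause for [d = 0] has the same role as in [polfun_derivative]. *)
Lemma polfun_div d f : polfun d f ->
  exists c (F : 'I_n -> V -> R), (forall i, polfun d.-1 (F i)) /\
    [/\ d = 0%N -> forall i x, F i x = 0 &
    forall x : V, f x = c + \sum_i x 0 i * F i x].
Proof.
have zero (c : R) : exists c' (F : 'I_n -> V -> R), (forall i, polfun 0 (F i)) /\
    [/\ 0%N = 0%N -> forall i x, F i x = 0 &
    forall x : V, c = c' + \sum_i x 0 i * F i x].
  exists c, (fun _ _ => 0); split=> [i|]; first exact: polfun_const.
  by split=> // x; rewrite big1 ?addr0// => i _; rewrite mulr0.
elim=> {d f} [c|j|d f g _ [c [F [pF [F0 fF]]]] _ [e [G [pG [G0 gG]]]]
    |d e f g pf [c [F [pF [F0 fF]]]] pg [b [G [pG [G0 gG]]]]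
    |d e f de _ [c [F [pF [F0 fF]]]]].
- exact: zero.
- exists 0, (fun i _ => (i == j)%:R); split=> [i|]; first exact: polfun_const.
  split=> // x; rewrite add0r (bigD1 j)//= eqxx mulr1 big1 ?addr0//.
  by move=> i /negbTE->; rewrite mulr0.
- exists (c + e), (fun i x => F i x + G i x); split=> [i|].
    exact: polfun_add.
  split=> [d0 i x|x]; first by rewrite F0// G0// addr0.
  rewrite fF gG addrACA -big_split; congr (_ + _).
  by apply: eq_bigr => i _; rewrite mulrDr.
- exists (c * b), (fun i x => c * G i x + F i x * g x); split=> [i|].
    apply: polfun_add.
      by apply: polfunZ; apply: polfun_le (pG i); rewrite -!subn1 leq_sub2r// leq_addl.
    case: d F0 pF {pf} => [F0 _|d _ pF].
      have -> : (fun x => F i x * g x) = fun=> 0.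
        by apply/funext => x; rewrite F0// mul0r.
      exact: polfun_const.
    by rewrite addSn; exact: polfun_mul.
  split=> [/eqP|x].
    rewrite addn_eq0 => /andP[/eqP d0 /eqP e0] i x.
    by rewrite F0// G0// mulr0 mul0r addr0.
  rewrite {1}fF mulrDl {1}gG mulrDr -addrA; congr (_ + _).
  rewrite mulr_sumr mulr_suml -big_split; apply: eq_bigr => i _ /=.
  by rewrite [RHS]mulrDr mulrCA !mulrA.
- exists c, F; split=> [i|].
    by apply: polfun_le (pF i); rewrite -!subn1 leq_sub2r.
  by split=> // e0; apply: F0; apply/eqP; rewrite -leqn0 -e0.
Qed.

End PolynomialFunctions.

(** * Polynomial functions on finite solution sets of pure-power equations *)

Section ReducedMonomials.
Variables (R : realType) (n k m : nat).
Variables (u : 'I_n -> 'rV[R]_n -> R) (Y : 'I_m -> 'rV[R]_n).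
Hypothesis polfun_u : forall i, polfun k (u i).
Hypothesis Y_eq : forall j i, Y j 0 i ^+ k.+1 = u i (Y j).
Local Notation expo := {ffun 'I_n -> 'I_k.+1}.

Let mon (a : expo) (x : 'rV[R]_n) := \prod_i x 0 i ^+ a i.
Let deg (a : expo) : nat := \sum_i a i.

(** Only the values at the points [Y j] matter. The total degree is recorded along with the reduced
    exponents, because rewriting a power must stay within reach of the induction hypothesis. *)
Let red d (phi : 'I_m -> R) := exists2 c : expo -> R,
  forall a, c a != 0 -> (deg a <= d)%N & forall j, phi j = \sum_a c a * mon a (Y j).

Let red_add d phi psi : red d phi -> red d psi -> red d (fun j => phi j + psi j).
Proof.
move=> [c cd phic] [b bd psib]; exists (fun a => c a + b a) => [a|j].
  have [c0|/cd//] := eqVneq (c a) 0; have [b0|/bd//] := eqVneq (b a) 0.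
  by rewrite c0 b0 addr0 eqxx.
by rewrite phic psib -big_split; apply: eq_bigr => a _; rewrite mulrDl.
Qed.

Let redZ d e phi : red d phi -> red d (fun j => e * phi j).
Proof.
move=> [c cd phic]; exists (fun a => e * c a) => [a|j].
  by rewrite mulf_eq0 negb_or => /andP[_ /cd].
by rewrite phic mulr_sumr; apply: eq_bigr => a _; rewrite mulrA.
Qed.

Let red_le d e phi : (d <= e)%N -> red d phi -> red e phi.
Proof. by move=> de [c cd phic]; exists c => // a /cd/leq_trans; apply. Qed.

Let red0 d : red d (fun=> 0).
Proof.
exists (fun=> 0) => [a|j]; first by rewrite eqxx.
by rewrite big1// => a _; rewrite mul0r.
Qed.

Let red_sum (I : finType) d (P : pred I) (phi : I -> 'I_m -> R) :
  (forall i, P i -> red d (phi i)) -> red d (fun j => \sum_(i | P i) phi i j).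
Proof.
move=> rphi; elim: (index_enum I) => [|i r IHr].
  rewrite (_ : (fun _ => _) = fun=> 0); first exact: red0.
  by apply/funext => j; rewrite big_nil.
rewrite (_ : (fun _ => _) = fun j => (if P i then phi i j else 0) +
    \sum_(i <- r | P i) phi i j).
  by apply: red_add => //; have := rphi i; case: (P i) => [|_]; [exact|exact: red0].
by apply/funext => j; rewrite big_cons; case: ifP; rewrite ?add0r.
Qed.

Let red_mon a d : (deg a <= d)%N -> red d (fun j => mon a (Y j)).
Proof.
move=> ad; exists (fun b => (b == a)%:R) => [b|j].
  by have [->//|_] := eqVneq b a; rewrite eqxx.
rewrite (bigD1 a)//= eqxx mul1r big1 ?addr0// => b /negbTE->.
by rewrite mul0r.
Qed.

(** Induction on the degree: split off a variable by [polfun_div], reduce the cofactor, then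
    multiply each reduced monomial by that variable again. *)
Let red_polfun d f : polfun d f -> red d (fun j => f (Y j)).
Proof.
have [s] := ubnP d; elim: s d f => // s IHs d f ds pf.
have [c [F [pF [F0 fF]]]] := polfun_div pf.
rewrite (_ : (fun _ => _) =
    fun j => c * mon [ffun=> ord0] (Y j) + \sum_i Y j 0 i * F i (Y j)); last first.
  apply/funext => j; rewrite fF; congr (_ + _).
  by rewrite /mon big1 ?mulr1// => i _; rewrite ffunE.
apply: red_add.
  apply: redZ; apply: red_mon; rewrite /deg big1// => i _; by rewrite ffunE.
apply: red_sum => i _; case: d ds pf pF F0 => [|d] ds pf pF F0.
  rewrite (_ : (fun _ => _) = fun=> 0); first exact: red0.
  by apply/funext => j; rewrite F0// mulr0.
have [b bd Fb] := IHs _ _ ds (pF i).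
rewrite (_ : (fun _ => _) =
    fun j => \sum_(a | b a != 0) b a * (Y j 0 i * mon a (Y j))); last first.
  apply/funext => j; rewrite Fb mulr_sumr [RHS]big_mkcond.
  apply: eq_bigr => a _; have [->|_] := eqVneq (b a) 0; last exact: mulrCA.
  by rewrite mul0r mulr0.
apply: red_sum => a /bd/= ad; apply: redZ.
have degE : deg a = (a i + \sum_(l | l != i) a l)%N by rewrite /deg (bigD1 i).
have monE b' x : mon b' x = x 0 i ^+ b' i * \prod_(l | l != i) x 0 l ^+ b' l.
  by rewrite /mon (bigD1 i).
have [ai|] := ltnP (a i) k.
  pose a' : expo := [ffun l => if l == i then inord (a i).+1 else a l].
  have a'i : a' i = (a i).+1 :> nat by rewrite ffunE eqxx inordK.
  have a'l l : l != i -> a' l = a l by rewrite ffunE => /negbTE->.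
  rewrite (_ : (fun _ => _) = fun j => mon a' (Y j)).
    apply: red_mon; rewrite /deg (bigD1 i)//= a'i addSn ltnS.
    by rewrite (eq_bigr (fun l => a l : nat)) -?degE// => l /a'l->.
  apply/funext => j; rewrite !monE mulrA -exprS a'i; congr (_ * _).
  by apply: eq_bigr => l /a'l->.
(* The exponent of variable [i] would become [k.+1]; that power is traded for [u i], of degree at
   most [k]. The product then has degree at most [deg a <= d], below the bound [d.+1] for [f], so
   the induction hypothesis applies. *)
move=> kai; have {kai}ai : a i = k :> nat.
  by apply/eqP; rewrite eqn_leq kai -ltnS ltn_ord.
rewrite (_ : (fun _ => _) =
    fun j => u i (Y j) * \prod_(l | l != i) Y j 0 l ^+ a l); last first.
  by apply/funext => j; rewrite monE mulrA -exprS ai Y_eq.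
apply: (red_le (leqnSn d)); apply: (red_le ad).
apply: (IHs _ (fun x => u i x * \prod_(l | l != i) x 0 l ^+ a l)).
  exact: leq_ltn_trans ad ds.
rewrite degE ai; apply: polfun_mul => //.
rewrite (_ : (fun _ => _) =
    fun x : 'rV[R]_n => \prod_l (if l != i then x 0 l ^+ a l else 1)).
  rewrite big_mkcond; apply: polfun_prod => l.
  case: ifP => _; last exact: polfun_const.
  by rewrite -[X in polfun X _]muln1; apply: polfunX; exact: polfun_coord.
by apply/funext => x; rewrite [LHS]big_mkcond.
Qed.

(** Indicators of the points are restrictions of polynomial functions, so reduced monomials span the
    [m]-dimensional space of functions on the points. There are [k.+1 ^ n] of them. *)
Lemma card_reduced_zeros : injective Y -> (m <= k.+1 ^ n)%N.
Proof.
move=> injY.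
pose dist2 (x y : 'rV[R]_n) := \sum_i (x 0 i - y 0 i) ^+ 2.
have dist2_eq0 x y : dist2 x y = 0 -> x = y.
  move/eqP; rewrite psumr_eq0 => [/allP xy|i _]; last exact: sqr_ge0.
  apply/rowP => i; apply/eqP; rewrite -subr_eq0 -sqrf_eq0.
  by apply: xy; rewrite mem_index_enum.
(* Lagrange interpolation with squared distances, which over the reals vanish only for equal
   points. *)
pose ind j (x : 'rV[R]_n) :=
  \prod_(l < m) (if l == j then 1 else dist2 x (Y l) / dist2 (Y j) (Y l)).
have indP j : exists d, polfun d (ind j).
  exists (\sum_(l < m) 2)%N; apply: polfun_prod => l.
  case: eqP => _; first exact: polfun_const.
  under eq_fun do rewrite mulrC.
  apply: polfunZ; apply: polfun_sum => i _; rewrite -[X in polfun X _]muln1.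
  by apply: polfunX; apply: polfunB; [exact: polfun_coord|exact: polfun_const].
have indE j l : ind j (Y l) = (l == j)%:R.
  have [->|lj] := eqVneq l j.
    rewrite /ind big1// => i _; case: eqVneq => // ij; rewrite divff//.
    by apply: contra_neq ij => /dist2_eq0/injY.
  rewrite /ind (bigD1 l)//= (negbTE lj) (_ : dist2 (Y l) (Y l) = 0) ?mul0r//.
  by rewrite /dist2 big1// => i _; rewrite subrr expr0n.
have coefP j : exists c : expo -> R,
    forall l, (l == j)%:R = \sum_a c a * mon a (Y l).
  have [d /red_polfun[c _ cE]] := indP j; exists c => l.
  by rewrite -cE indE.
have [c cE] := choice coefP.
have -> : (k.+1 ^ n)%N = #|{: expo}| by rewrite card_ffun !card_ord.
pose A : 'M[R]_(m, #|{: expo}|) := \matrix_(j, a) c j (enum_val a).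
pose B : 'M[R]_(#|{: expo}|, m) := \matrix_(a, l) mon (enum_val a) (Y l).
suff /mulmx1_min : A *m B = 1%:M by [].
apply/matrixP => j l; rewrite !mxE [LHS](_ : _ = \sum_a c j a * mon a (Y l)).
  by rewrite -cE eq_sym.
rewrite [RHS](reindex _ (onW_bij _ (enum_val_bij expo))).
by apply: eq_bigr => a _; rewrite !mxE.
Qed.

End ReducedMonomials.

(** * Relatively open classes of a semialgebraic set *)

Lemma horner_local_max (R : realType) (p : {poly R}) e :
  0 < e -> (forall t, `|t| < e -> p.[t] <= p.[0]) -> p`_1 = 0.
Proof.
move=> e0 pmax.
have inE t : t \in `](- e), e[%R = (`|t| < e) by rewrite in_itv/= ltr_norml.
have /(@derive_val _ _ _ _ _ _ _) : is_derive (0 : R) 1 (horner p) 0.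
  apply: (@derive1_at_max _ _ (- e) e).
  - by lra.
  - by move=> t _; exact: derivable_horner.
  - by rewrite inE normr0.
  - by move=> t; rewrite inE; exact: pmax.
by rewrite derive_val horner_coef0 coef_deriv mulr1n.
Qed.

Section FinitelyManyClasses.
Variables (R : realType) (n : nat).
Local Notation V := 'rV[R]_n.

Lemma expr_norm_le_sum (x : V) k :
  `|x| ^+ (k.+1).*2 <= \sum_i x 0 i ^+ (k.+1).*2.
Proof.
have xe i : 0 <= x 0 i ^+ (k.+1).*2 by rewrite -mul2n exprM exprn_ge0// sqr_ge0.
have [x0|x0] := eqVneq `|x| 0; first by rewrite x0 expr0n sumr_ge0.
have [[i j]] := mx_norm_neq0 x0; rewrite -[mx_norm x]/(`|x|) ord1/= => ->.
rewrite (bigD1 j)//= -normrX ger0_norm// lerDl; exact: sumr_ge0.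
Qed.

(** The penalty has degree [2d+2], one above the bound for [F], and wins at infinity: for
    [|x| >= 1], membership gives [del |x|^(2d+2) <= F x <= C (2|x|)^(2d+1)], hence the radius
    [C 2^(2d+1) / del]. *)
Lemma compact_superlevel (F : V -> R) d del c :
  polfun (d.*2).+1 F -> 0 < del -> 0 <= c ->
  compact [set x : V | c <= F x - del * \sum_i x 0 i ^+ (d.+1).*2].
Proof.
move=> pF del0 c0; apply: bounded_closed_compact.
  have [C C0 FC] := polfun_bounded pF.
  exists (1 + C * 2 ^+ (d.*2).+1 / del); split; first exact: num_real.
  move=> b bC x /= cx; apply: ltW; apply: le_lt_trans bC.
  have [x1|/ltW x1] := leP `|x| 1.
    by apply: le_trans x1 _; rewrite lerDl divr_ge0 ?(ltW del0)// mulr_ge0// exprn_ge0.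
  have xgt0 : 0 < `|x| by exact: lt_le_trans x1.
  apply: le_trans (_ : C * 2 ^+ (d.*2).+1 / del <= _); last by rewrite lerDr.
  rewrite ler_pdivlMr// -(ler_pM2r (exprn_gt0 (d.*2).+1 xgt0)).
  rewrite mulrAC -exprS -doubleS. rewrite -[leRHS]mulrA -exprMn.
  apply: le_trans (_ : F x <= _); last first.
    apply: le_trans (ler_norm _) (le_trans (FC x) _).
    rewrite ler_wpM2l// lerXn2r// ?nnegrE ?mulr_ge0// ?addr_ge0//.
    by rewrite mulr2n mulrDl mul1r lerD2r.
  rewrite mulrC; apply: le_trans (_ : del * \sum_i x 0 i ^+ (d.+1).*2 <= _).
    by rewrite ler_pM2l// expr_norm_le_sum.
  by rewrite -subr_ge0; exact: le_trans cx.
rewrite -[X in closed X]/((fun x : V => F x - del * \sum_i x 0 i ^+ (d.+1).*2)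
  @^-1` [set y | c <= y]).
apply: preimage_closed => [x _|]; last exact: closed_ge.
apply: (@polfun_continuous _ _ (maxn (d.*2).+1 (d.+1).*2)).
apply: polfunB; first exact: polfun_le (leq_maxl _ _) pF.
apply: polfun_le (leq_maxr _ _) _; apply: polfunZ; apply: polfun_sum => i _.
by rewrite -[X in polfun X _]muln1; apply: polfunX; exact: polfun_coord.
Qed.

(** The bound [N] is fixed before the points: it depends on the degrees and on [n] alone, while
    [del], [c] and [M] are adapted to each choice of representatives. *)
Lemma finitely_many_open_classes (h f : V -> R) dh df (E : V -> V -> Prop) :
    polfun dh h -> polfun df f ->
    (forall x y, E x y -> E y x) ->
    (forall x y z, E x y -> E y z -> E x z) ->
    (forall x, h x = 0 -> f x != 0 -> exists2 r, 0 < r &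
       forall y, h y = 0 -> f y != 0 -> `|x - y| < r -> E x y) ->
  exists N, forall m (p : 'I_m -> V),
    (forall j, h (p j) = 0) -> (forall j, f (p j) != 0) ->
    (forall j l, E (p j) (p l) -> j = l) -> (m <= N)%N.
Proof.
move=> ph pf Esym Etrans Eopen; pose d := (dh + df)%N.
exists ((d.*2).+1 ^ n)%N => m p hp fp pE.
pose F x := f x ^+ 2; pose H x := h x ^+ 2.
have pF : polfun (d.*2).+1 F.
  apply: polfun_le (polfunX 2 pf); rewrite mul2n; apply: leqW.
  by rewrite leq_double leq_addl.
have pH : polfun (d.*2).+1 H.
  apply: polfun_le (polfunX 2 ph); rewrite mul2n; apply: leqW.
  by rewrite leq_double leq_addr.
pose q (x : V) := \sum_i x 0 i ^+ (d.+1).*2.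
have q_ge0 x : 0 <= q x.
  by apply: sumr_ge0 => i _; rewrite -mul2n exprM exprn_ge0// sqr_ge0.
have Fp_gt0 j : 0 < F (p j) by rewrite /F lt_def sqrf_eq0 fp sqr_ge0.
have [del del0 [c c0 cp]] : exists2 del, 0 < del &
    exists2 c, 0 < c & forall j, c <= F (p j) - del * q (p j).
  (* The inverse of a sum of inverses lies below every [F (p j)], and [b] lies above every
     [q (p j)]. With [del = e / b / 2] the penalty costs at most [e / 2] at each [p j], which leaves
     [c = e / 2]. *)
  pose e := (1 + \sum_j (F (p j))^-1)^-1.
  have sF_ge0 : 0 <= \sum_j (F (p j))^-1.
    by apply: sumr_ge0 => j _; rewrite invr_ge0 ltW.
  have e0 : 0 < e by rewrite invr_gt0 ltr_pwDl.
  pose b := 1 + \sum_j q (p j).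
  have b0 : 0 < b by rewrite ltr_pwDl// sumr_ge0.
  exists (e / b / 2); first by rewrite !divr_gt0.
  exists (e / 2) => [|j]; first exact: divr_gt0.
  have eF : e <= F (p j).
    rewrite -[leRHS]invrK lef_pV2 ?posrE ?invr_gt0// ?ltr_pwDl//.
    rewrite (bigD1 j)//= addrCA lerDl addr_ge0// sumr_ge0// => i _.
    by rewrite invr_ge0 ltW.
  have qb : e / b * q (p j) <= e.
    rewrite mulrAC ler_pdivrMr// ler_pM2l// /b (bigD1 j)//= addrCA lerDl.
    by rewrite addr_ge0// sumr_ge0.
  rewrite mulrAC; lra.
pose G x := F x - del * q x.
have G_cont : continuous G.
  apply: (@polfun_continuous _ _ (d.+1).*2); apply: polfunB.
    exact: polfun_le pF.
  apply: polfunZ; apply: polfun_sum => i _.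
  by rewrite -[X in polfun X _]muln1; apply: polfunX; exact: polfun_coord.
pose K := [set x | h x = 0 /\ c <= G x].
have KX x : K x -> f x != 0.
  move=> [_ cG]; rewrite -sqrf_eq0 gt_eqF//.
  apply: lt_le_trans c0 (le_trans cG _).
  by rewrite lerBlDr lerDl mulr_ge0// ltW.
have [r r0 rE] : exists2 r : V -> R, forall x, 0 < r x & forall x, K x ->
    forall y, h y = 0 -> f y != 0 -> `|x - y| < r x -> E x y.
  have /choice[r rP] : forall x, exists r, 0 < r /\ (K x ->
      forall y, h y = 0 -> f y != 0 -> `|x - y| < r -> E x y).
    move=> x; have [Kx|nKx] := pselect (K x); last by exists 1.
    by have [r r0 rE] := Eopen x Kx.1 (KX _ Kx); exists r.
  by exists r => x; have [] := rP x.
(* Radii are divided by three so that, when two balls meet, the centres are closer than two thirds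
   of the larger radius. *)
have near_E x x' z : K x -> K x' -> `|x - z| < r x / 3 -> `|x' - z| < r x' / 3 ->
    E x x'.
  move=> Kx Kx' xz xz'.
  have xx' : `|x - x'| <= `|x - z| + `|x' - z|.
    by rewrite [ `|x' - z|]distrC; exact: ler_distD.
  have rx := r0 x; have rx' := r0 x'; have [rr|/ltW rr] := leP (r x') (r x).
    by apply: rE => //; [exact: Kx'.1|exact: KX|lra].
  apply: Esym; apply: rE => //; [exact: Kx.1|exact: KX|].
  by rewrite distrC; lra.
pose O A := \bigcup_(x in K `&` A) ball x (r x / 3).
have O_open A : open (O A).
  by apply: bigcup_open => x _; exact: ball_open.
have OE A z : O A z <-> exists x, [/\ K x, A x & `|x - z| < r x / 3].
  split=> [[x [Kx Ax]]|[x [Kx Ax xz]]]; first by rewrite -ball_normE; exists x.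
  by exists x => //; rewrite -ball_normE.
(* Outside the balls [h] has no zero with [c <= G], so by compactness [H] has a positive minimum
   there, and a large multiple of it pushes [G] below [c]. The superlevel set of [G - M * H] is thus
   covered by the balls. *)
have [M M0 HM] : exists2 M, 0 <= M &
    forall z, c <= G z -> ~ O setT z -> G z - M * H z < c.
  pose B := [set x | c <= G x] `&` ~` O setT.
  have cB : compact B.
    apply: compact_closedI; first exact: compact_superlevel (ltW c0).
    exact: open_closedC.
  have [B0|/set0P Bn0] := eqVneq B set0.
    by exists 0 => // z cz Oz; have : B z by []; rewrite B0.
  have [z0 /set_mem[z0G z0O] Hz0] : exists2 z0, z0 \in B & forall t, t \in B -> H z0 <= H t.
    apply: compact_EVT_min => //; apply: continuous_subspaceT.
    exact: polfun_continuous pH.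
  have [z1 /set_mem[z1G _] Gz1] : exists2 z1, z1 \in B & forall t, t \in B -> G t <= G z1.
    by apply: compact_EVT_max => //; exact: continuous_subspaceT.
  have Hz0_gt0 : 0 < H z0.
    rewrite /H exprn_even_gt0//=; apply: contra_notN z0O => /eqP h0.
    by apply/OE; exists z0; split=> //; rewrite subrr normr0 divr_gt0.
  have Gz1_gt0 : 0 < G z1 by exact: lt_le_trans z1G.
  exists (G z1 / H z0) => [|z zG zO]; first by rewrite divr_ge0// ltW.
  have Bz : z \in B by rewrite inE.
  apply: le_lt_trans c0; rewrite subr_le0 (le_trans (Gz1 _ Bz))//.
  by rewrite mulrAC ler_pdivlMr// ler_pM2l// Hz0.
pose P x := F x - M * H x.
have pP : polfun (d.*2).+1 P by apply: polfunB => //; exact: polfunZ.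
pose GM x := P x - del * q x.
have GME x : GM x = G x - M * H x by rewrite /GM /P /G; ring.
have GM_le x : GM x <= G x.
  by rewrite GME lerBlDr lerDl mulr_ge0// sqr_ge0.
have GMO z : c <= GM z -> exists2 x, K x & `|x - z| < r x / 3.
  move=> cz; have cGz := le_trans cz (GM_le z).
  have [/OE[x [Kx _ xz]]|/(HM _ cGz)] := pselect (O setT z); first by exists x.
  by rewrite -GME ltNge cz.
(* Removing the open balls centred outside the class of [p j] leaves a compact set, nonempty because
   it contains [p j]; the rest of the superlevel set lies in balls centred in that class. *)
have /choice[z zP] j : exists z, [/\ c <= GM z, ~ O (~` E (p j)) z &
    forall y, c <= GM y -> ~ O (~` E (p j)) y -> GM y <= GM z].
  pose T := [set x | c <= GM x] `&` ~` O (~` E (p j)).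
  have cT : compact T.
    apply: compact_closedI; first exact: compact_superlevel (ltW c0).
    exact: open_closedC.
  have [||z /set_mem[zc zO] zmax] := @compact_EVT_max _ _ GM T _ cT.
  - exists (p j); split; first by rewrite /= GME /H hp expr0n mulr0 subr0; exact: cp.
    move=> /OE[x [Kx Ex xp]]; apply: Ex; apply: Esym; apply: rE => //.
    by apply: lt_le_trans xp _; have := r0 x; lra.
  - apply: continuous_subspaceT.
    apply: (@polfun_continuous _ _ (d.+1).*2); apply: polfunB.
      exact: polfun_le pP.
    apply: polfunZ; apply: polfun_sum => i _.
    by rewrite -[X in polfun X _]muln1; apply: polfunX; exact: polfun_coord.
  by exists z; split=> // y cy Oy; apply: zmax; rewrite inE.
have zE j x : K x -> `|x - z j| < r x / 3 -> E (p j) x.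
  move=> Kx xz; have [_ zO _] := zP j.
  by apply: contra_notP zO => Ex; apply/OE; exists x.
have z_inj : injective z.
  move=> j l zjl; apply: pE; have [cz _ _] := zP j.
  have [x Kx xz] := GMO _ cz.
  by apply: Etrans (zE _ _ Kx xz) _; apply: Esym; apply: zE; rewrite -?zjl.
(* The constrained maximum is a free local one: a point near [z j] stays in the ball around [x], so
   it either falls below the level [c] or, by [near_E], avoids all balls of other classes. *)
have z_max j : exists2 e, 0 < e & forall y, `|y - z j| < e -> GM y <= GM (z j).
  have [cz zO zmax] := zP j; have [x Kx xz] := GMO _ cz.
  exists (r x / 3 - `|x - z j|) => [|y yz]; first by rewrite subr_gt0.
  have xy : `|x - y| < r x / 3.
    apply: le_lt_trans (ler_distD (z j) _ _) _.
    by rewrite -ltrBrDl [ `|z j - y|]distrC.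
  have [cy|/ltW yc] := leP c (GM y); last exact: le_trans cz.
  apply: zmax => // /OE[x' [Kx' Ex' xy']]; apply: Ex'.
  by apply: Etrans (zE _ _ Kx xz) _; exact: near_E xy xy'.
have /choice[P' P'P] i := polfun_derivative i pP.
pose b : R := del * (d.+1).*2%:R.
have b0 : b != 0 by rewrite mulf_neq0 ?pnatr_eq0// gt_eqF.
apply: (@card_reduced_zeros _ _ d.*2 _ (fun i x => b^-1 * P' i x) z) => //.
  by move=> i; apply: polfunZ; have [] := P'P i.
move=> j i; apply: (mulfI b0); rewrite mulrA divff// mul1r; apply/eqP.
have [_ _ /(_ (z j))[s sP <-]] := P'P i.
(* The restriction of [GM] to the line through [z j] in direction [i]. Its linear coefficient
   vanishes, which equates [P' i (z j)] with [b] times the power [(d.*2).+1] of the coordinate. *)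
pose w := s - del *: ((z j 0 i)%:P + 'X) ^+ (d.+1).*2
  - (del * \sum_(l | l != i) z j 0 l ^+ (d.+1).*2)%:P.
have wE t : w.[t] = GM (z j + t *: delta_mx 0 i).
  rewrite /w /GM sP 2!hornerD 2!hornerN hornerZ horner_exp hornerD hornerX !hornerC.
  rewrite -addrA -opprD -mulrDr; congr (_ - _ * _).
  rewrite /q [RHS](bigD1 i)// 3!mxE !eqxx mulr1; congr (_ + _).
  by apply: eq_bigr => l li; rewrite 3!mxE (negbTE li) andbF mulr0 addr0.
have [e e0 emax] := z_max j.
have : w`_1 = 0.
  apply: (horner_local_max e0) => t te; rewrite !wE scale0r addr0; apply: emax.
  rewrite addrC addKr normrZ; apply: le_lt_trans te.
  rewrite -[leRHS]mulr1 ler_wpM2l//.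
  by apply: normr_mx_le => // k l; rewrite !mxE; case: (_ && _); rewrite ?normr1 ?normr0.
have coef1 (a : {poly R}) : a`_1 = a^`().[0].
  by rewrite horner_coef0 coef_deriv.
rewrite !coefB coefC coefZ subr0 => /eqP; rewrite subr_eq0 => /eqP->.
rewrite coef1 deriv_exp derivD derivC derivX add0r hornerMn hornerM horner_exp.
rewrite hornerD hornerX !hornerC addr0 mul1r /=; by rewrite -mulr_natr; apply/eqP; rewrite /b; ring.
Qed.

End FinitelyManyClasses.

(** * Norms and limits in finite-dimensional spaces *)

Section CoordinateNorm.
Variable R : realType.
Implicit Types U V W : vectType R.

(** The sup norm of coordinates need not be submultiplicative for composition or for the bracket;
    later estimates therefore carry constants from the boundedness lemmas. *)
Definition vnorm V (x : V) : R := `|v2r x|.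

Lemma vnorm_ge0 V (x : V) : 0 <= vnorm x.
Proof. exact: normr_ge0. Qed.

Lemma vnorm0 V : vnorm (0 : V) = 0.
Proof. by rewrite /vnorm linear0 normr0. Qed.

Lemma vnorm_eq0 V (x : V) : vnorm x = 0 -> x = 0.
Proof. by move/normr0_eq0 => x0; apply: (can_inj v2rK); rewrite x0 linear0. Qed.

Lemma vnormD V (x y : V) : vnorm (x + y) <= vnorm x + vnorm y.
Proof. by rewrite /vnorm linearD ler_normD. Qed.

Lemma vnormN V (x : V) : vnorm (- x) = vnorm x.
Proof. by rewrite /vnorm linearN normrN. Qed.

Lemma vnormB V (x y : V) : vnorm (x - y) <= vnorm x + vnorm y.
Proof. by rewrite -[vnorm y]vnormN vnormD. Qed.

Lemma vnormBC V (x y : V) : vnorm (x - y) = vnorm (y - x).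
Proof. by rewrite -vnormN opprB. Qed.

Lemma vnormZ V a (x : V) : vnorm (a *: x) = `|a| * vnorm x.
Proof. by rewrite /vnorm linearZ normrZ. Qed.

Lemma vnorm_sum V (I : Type) (r : seq I) (P : pred I) (F : I -> V) :
  vnorm (\sum_(i <- r | P i) F i) <= \sum_(i <- r | P i) vnorm (F i).
Proof.
elim/big_ind2: _ => [|x a y b xa yb|//]; first by rewrite vnorm0.
exact: le_trans (vnormD _ _) (lerD xa yb).
Qed.

Lemma r2v_coordE V (x : V) : x = \sum_i v2r x 0 i *: r2v (delta_mx 0 i).
Proof.
rewrite -[LHS]v2rK [v2r x in LHS]row_sum_delta linear_sum.
by apply: eq_bigr => i _; rewrite linearZ.
Qed.

Lemma linear_bounded U V (f : U -> V) : linear f ->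
  exists2 C, 0 < C & forall x, vnorm (f x) <= C * vnorm x.
Proof.
move=> lf; pose g := HB.pack_for {linear U -> V} f
  (GRing.isLinear.Build R U V *:%R f lf).
exists (1 + \sum_i vnorm (g (r2v (delta_mx 0 i)))) => [|x].
  by rewrite ltr_pwDl// sumr_ge0// => i _; exact: vnorm_ge0.
rewrite -[f]/(g : U -> V) {1}(r2v_coordE x) linear_sum.
apply: le_trans (vnorm_sum _ _ _) _.
rewrite mulrDl mul1r mulr_suml ler_wpDl ?vnorm_ge0// ler_sum// => i _.
by rewrite linearZ vnormZ mulrC ler_wpM2l ?vnorm_ge0// normr_coord_le.
Qed.

Lemma linear_form_bounded V (f : V -> R) : linear (f : V -> R^o) ->
  exists2 C, 0 < C & forall x, `|f x| <= C * vnorm x.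
Proof.
move=> lf; pose g := HB.pack_for {linear V -> R^o} (f : V -> R^o)
  (GRing.isLinear.Build R V R^o *:%R (f : V -> R^o) lf).
exists (1 + \sum_i `|g (r2v (delta_mx 0 i))|) => [|x].
  by rewrite ltr_pwDl// sumr_ge0.
rewrite -[f]/(g : V -> R^o) {1}(r2v_coordE x) linear_sum.
apply: le_trans (ler_norm_sum _ _ _) _.
rewrite mulrDl mul1r mulr_suml ler_wpDl ?vnorm_ge0// ler_sum// => i _.
by rewrite linearZ normrM mulrC ler_wpM2l// normr_coord_le.
Qed.

Lemma bilinear_bounded U V W (f : U -> V -> W) :
  (forall x, linear (f x)) -> (forall y, linear (f^~ y)) ->
  exists2 C, 0 < C & forall x y, vnorm (f x y) <= C * vnorm x * vnorm y.
Proof.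
move=> fl fr.
have /choice[C CP] i : exists C, 0 < C /\
    forall y, vnorm (f (r2v (delta_mx 0 i)) y) <= C * vnorm y.
  by have [C ? ?] := linear_bounded (fl (r2v (delta_mx 0 i))); exists C.
exists (1 + \sum_i C i) => [|x y].
  by rewrite ltr_pwDl// sumr_ge0// => i _; have [/ltW] := CP i.
pose g := HB.pack_for {linear U -> W} (f^~ y)
  (GRing.isLinear.Build R U W *:%R (f^~ y) (fr y)).
rewrite -[f x y]/(g x) {1}(r2v_coordE x) linear_sum.
apply: le_trans (vnorm_sum _ _ _) _.
rewrite mulrDl mul1r mulrDl ler_wpDl ?mulr_ge0 ?vnorm_ge0//.
rewrite !mulr_suml ler_sum// => i _; have [C0 fC] := CP i.
rewrite linearZ vnormZ mulrAC mulrC ler_pM ?vnorm_ge0//; first exact: fC.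
exact: normr_coord_le.
Qed.

(** Stated through a real sequence, it makes sense for every [vectType R], in particular for the
    realifications of [g] and ['End(g)]. *)
Definition tends V (u : nat -> V) (l : V) :=
  (fun n => vnorm (u n - l)) @ \oo --> (0 : R).

Lemma tends_squeeze V (u : nat -> V) l (e : nat -> R) :
  (forall n, vnorm (u n - l) <= e n) -> e @ \oo --> (0 : R) -> tends u l.
Proof.
move=> ue e0; apply: squeeze_cvgr (cvg_cst 0) e0.
by near=> n; rewrite vnorm_ge0 ue.
Unshelve. all: by end_near.
Qed.

Lemma tends_cst V (x : V) : tends (fun=> x) x.
Proof.
apply: (@tends_squeeze _ _ _ (fun=> 0)) => [n|]; last exact: cvg_cst.
by rewrite subrr vnorm0.
Qed.

Lemma tendsD V (u v : nat -> V) a b :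
  tends u a -> tends v b -> tends (fun n => u n + v n) (a + b).
Proof.
move=> ua vb; apply: (@tends_squeeze _ _ _
  (fun n => vnorm (u n - a) + vnorm (v n - b))) => [n|].
  by rewrite opprD addrACA vnormD.
by rewrite -[0 in X in _ --> X]addr0; exact: cvgD.
Qed.

Lemma tends_linear U V (f : U -> V) u a :
  linear f -> tends u a -> tends (f \o u) (f a).
Proof.
move=> lf ua; have [C C0 fC] := linear_bounded lf.
pose g := HB.pack_for {linear U -> V} f
  (GRing.isLinear.Build R U V *:%R f lf).
apply: (@tends_squeeze _ _ _ (fun n => C * vnorm (u n - a))) => [n|].
  by rewrite -(raddfB g); exact: fC.
by rewrite -[0 in X in _ --> X](mulr0 C); exact: cvgMr.
Qed.

Lemma tendsN V (u : nat -> V) a : tends u a -> tends (fun n => - u n) (- a).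
Proof.
by apply: tends_linear => r x y; rewrite opprD scalerN.
Qed.

Lemma tendsB V (u v : nat -> V) a b :
  tends u a -> tends v b -> tends (fun n => u n - v n) (a - b).
Proof. by move=> ua /tendsN; exact: tendsD. Qed.

Lemma tends_bilinear U V W (f : U -> V -> W) u v a b :
  (forall x, linear (f x)) -> (forall y, linear (f^~ y)) ->
  tends u a -> tends v b -> tends (fun n => f (u n) (v n)) (f a b).
Proof.
move=> fl fr ua vb; have [C C0 fC] := bilinear_bounded fl fr.
pose g x := HB.pack_for {linear V -> W} (f x)
  (GRing.isLinear.Build R V W *:%R (f x) (fl x)).
pose h y := HB.pack_for {linear U -> W} (f^~ y)
  (GRing.isLinear.Build R U W *:%R (f^~ y) (fr y)).
have fE n : f (u n) (v n) - f a b = f (u n - a) (v n) + f a (v n - b).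
  have -> : f (u n - a) (v n) = f (u n) (v n) - f a (v n) := raddfB (h (v n)) _ _.
  have -> : f a (v n - b) = f a (v n) - f a b := raddfB (g a) _ _.
  by rewrite addrA subrK.
apply: (@tends_squeeze _ _ _ (fun n =>
    C * vnorm (u n - a) * (vnorm (v n - b) + vnorm b)
    + C * vnorm a * vnorm (v n - b))) => [n|].
  rewrite fE; apply: le_trans (vnormD _ _) _; apply: lerD; last exact: fC.
  apply: le_trans (fC _ _) _; rewrite ler_wpM2l ?mulr_ge0 ?vnorm_ge0 ?(ltW C0)//.
  by rewrite -{1}(subrK b (v n)) vnormD.
rewrite -[0 in X in _ --> X](_ : C * 0 * (0 + vnorm b) + C * vnorm a * 0 = 0); last first.
  by rewrite !mulr0 mul0r addr0.
apply: cvgD; last exact: cvgMr.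
apply: cvgM; first exact: cvgMr.
by apply: cvgD => //; exact: cvg_cst.
Qed.

Lemma tends_shift V k (u : nat -> V) a :
  tends u a -> tends (fun n => u (n + k)%N) a.
Proof.
rewrite /tends -(@cvg_shiftn k _ (fun n => vnorm (u n - a))) => ua.
exact: ua.
Qed.

Lemma tends_le V (u : nat -> V) a e :
  tends u a -> (forall n, vnorm (u n) <= e) -> vnorm a <= e.
Proof.
move=> ua ue; apply/ler_addgt0Pl => d d0.
have /cvgrPdist_lt/(_ d d0)[N _ /(_ N (leqnn N))] : (fun n => vnorm (u n - a)) @ \oo --> (0 : R) := ua.
rewrite /= sub0r normrN ger0_norm ?vnorm_ge0// => uNa.
rewrite -[a](subKr (u N)) (le_trans (vnormB _ _))// addrC lerD//.
exact: ltW.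
Qed.

Lemma tends_unique V (u : nat -> V) a b : tends u a -> tends u b -> a = b.
Proof.
move=> ua ub; apply/eqP; rewrite -subr_eq0; apply/eqP/vnorm_eq0/eqP.
rewrite eq_le vnorm_ge0 andbT; apply: tends_le (tendsB ua ub) _ => n.
by rewrite subrr vnorm0.
Qed.

(** Subspaces are closed: projection to [U] is continuous and fixes every term, so it fixes the
    limit. *)
Lemma tends_mem V (U : {vspace V}) u a :
  (forall n, u n \in U) -> tends u a -> a \in U.
Proof.
move=> uU ua.
suff -> : a = projv U a by exact: memv_proj.
apply: (tends_unique ua).
rewrite (_ : u = projv U \o u); last first.
  by apply/funext => n /=; rewrite projv_id.
by apply: tends_linear ua => r x y; rewrite linearP.
Qed.

End CoordinateNorm.

(** * Dominated series, and limits in complex coordinates *)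

Section Convergence.
Variable R : realType.

Lemma tends_series (V : vectType R) (u : nat -> V) (b : nat -> R) :
  (forall k, vnorm (u k) <= b k) -> cvgn (series b) ->
  exists l, tends (fun n => \sum_(k < n) u k) l.
Proof.
move=> ub cb.
pose c i k := v2r (u k) 0 i.
have cc i : cvgn (series (c i)).
  apply: normed_cvg; apply: series_le_cvg cb => k.
    exact: normr_ge0.
    exact: le_trans (vnorm_ge0 _) (ub k).
  exact: le_trans (normr_coord_le _ _ _) (ub k).
pose l : V := r2v (\row_i limn (series (c i))).
exists l; apply: (@tends_squeeze _ _ _ _
    (fun n => \sum_i `|series (c i) n - limn (series (c i))|)) => [n|].
  apply: normr_mx_le => [|j i]; first exact: sumr_ge0.
  rewrite (ord1 j) (bigD1 i)//= -[leLHS]addr0 lerD ?sumr_ge0//.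
  rewrite linearB /= /l r2vK !mxE linear_sum summxE /series/= big_mkord.
  exact: lexx.
rewrite -[0 in X in _ --> X](_ : \sum_i `|limn (series (c i)) - limn (series (c i))| = 0).
  apply: cvg_big => [|i _]; first exact: add_continuous.
  apply: cvg_norm; apply: cvgB; last exact: cvg_cst.
  exact: cc.
by rewrite big1// => i _; rewrite subrr normr0.
Qed.

Lemma normc_le_sum (z : R[i]) : `|z| <= (`|complex.Re z| + `|complex.Im z|)%:C%C.
Proof.
case: z => a b; rewrite normc_def lecR.
rewrite -[leRHS]ger0_norm ?addr_ge0// -sqrtr_sqr ler_wsqrtr//.
rewrite sqrrD -!normrX !(ger0_norm (sqr_ge0 _)) -addrA lerD2l.
by rewrite lerDr mulrn_wge0// mulr_ge0.
Qed.

Definition coord_lim (F : numFieldType) (V : vectType F) (u : nat -> V) : V :=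
  r2v (lim ((fun n => v2r (u n)) @ \oo)).

Lemma coord_limE (F : numFieldType) (V : vectType F) (u : nat -> V) l :
  (forall e : F, 0 < e -> exists N, forall n, (N <= n)%N ->
     forall j, `|v2r (u n) 0 j - v2r l 0 j| < e) -> coord_lim u = l.
Proof.
move=> ul; rewrite -[RHS]v2rK; congr r2v.
apply: cvg_lim; first exact: norm_hausdorff.
apply/cvg_ballP => e e0; have [N uN] := ul _ e0.
exists N => // n /uN une; split=> // i j.
by rewrite (ord1 i) -ball_normE/= distrC.
Qed.

Lemma complex_coord_bounded (V : vectType R[i]) : exists2 C, 0 < C &
  forall (x : V) j, `|complex.Re (v2r x 0 j)| + `|complex.Im (v2r x 0 j)|
    <= C * vnorm (x : realification R V).
Proof.
have coordP (x y : V) r j : v2r ((r *: (x : realification R V) + y : realification R V) : V) 0 j =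
    r%:C%C * v2r x 0 j + v2r y 0 j.
  by rewrite real_scaleE linearD linearZ !mxE.
have /choice[C CP] j : exists C, 0 < C /\ forall x : V,
    `|complex.Re (v2r x 0 j)| <= C * vnorm (x : realification R V).
  have [|C ? ?] := @linear_form_bounded R (realification R V)
    (fun x => complex.Re (v2r (x : V) 0 j)); last by exists C.
  move=> r x y; rewrite coordP; case: (v2r (x : V) 0 j) (v2r (y : V) 0 j) => [a b] [c d] /=.
  by rewrite mul0r subr0.
have /choice[D DP] j : exists C, 0 < C /\ forall x : V,
    `|complex.Im (v2r x 0 j)| <= C * vnorm (x : realification R V).
  have [|D ? ?] := @linear_form_bounded R (realification R V)
    (fun x => complex.Im (v2r (x : V) 0 j)); last by exists D.
  move=> r x y; rewrite coordP; case: (v2r (x : V) 0 j) (v2r (y : V) 0 j) => [a b] [c d] /=.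
  by rewrite mul0r addr0.
have CD0 j : 0 <= C j + D j.
  by have [/ltW ? _] := CP j; have [/ltW ? _] := DP j; exact: addr_ge0.
exists (1 + \sum_j (C j + D j)) => [|x j]; first by rewrite ltr_pwDl// sumr_ge0.
apply: le_trans (lerD ((CP j).2 x) ((DP j).2 x)) _.
rewrite -mulrDl ler_wpM2r ?vnorm_ge0// (bigD1 j)//= addrCA lerDl.
by rewrite addr_ge0// sumr_ge0.
Qed.

(** The bridge from the limit over [R[i]] in [lfun_exp] to real estimates: real and imaginary parts
    of complex coordinates are real linear forms, hence bounded by [vnorm]. *)
Lemma coord_lim_tends (V : vectType R[i]) (u : nat -> V) (l : V) :
  tends (u : nat -> realification R V) l -> coord_lim u = l.
Proof.
move=> ul; apply: coord_limE => -[a b]; rewrite ltcE/= => /andP[/eqP-> a0].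
have [C C0 CP] := complex_coord_bounded V.
have d0 : 0 < a / C by rewrite divr_gt0.
have /cvgrPdist_lt/(_ _ d0)[N _ uN] :
  (fun n => vnorm (u n - l : realification R V)) @ \oo --> (0 : R) := ul.
exists N => n /uN /=; rewrite sub0r normrN ger0_norm ?vnorm_ge0// => und j.
apply: le_lt_trans (normc_le_sum _) _; rewrite ltcR.
have -> : v2r (u n) 0 j - v2r l 0 j = v2r (u n - l) 0 j by rewrite linearB !mxE.
by apply: le_lt_trans (CP _ _) _; rewrite mulrC -ltr_pdivlMr.
Qed.

End Convergence.

(** * The exponential of an endomorphism *)

Section Exponential.
Variables (R : realType) (V : vectType R[i]).
Local Notation E := (realification R 'End(V)).
Implicit Types f h : 'End(V).

Lemma realification_linear (U W : vectType R[i]) (f : U -> W) :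
  linear f -> linear (f : realification R U -> realification R W).
Proof. by move=> lf r x y; exact: lf. Qed.

Lemma comp_bounded : exists2 C, 0 < C & forall f h,
  vnorm ((f \o h)%VF : E) <= C * vnorm (f : E) * vnorm (h : E).
Proof.
have [f|h|C C0 CP] := @bilinear_bounded R E E E
  (fun f h => (f : 'End(V)) \o (h : 'End(V)))%VF; last by exists C.
  by apply: realification_linear => r x y; rewrite comp_lfunDr comp_lfunZr.
by apply: realification_linear => r x y; rewrite comp_lfunDl comp_lfunZl.
Qed.

Lemma lfun_apply_bounded : exists2 C, 0 < C & forall f x,
  vnorm (f x : realification R V)
    <= C * vnorm (f : E) * vnorm (x : realification R V).
Proof.
have [f|x|C C0 CP] := @bilinear_bounded R E (realification R V) (realification R V)
  (fun f x => (f : 'End(V)) (x : V)); last by exists C.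
  by apply: realification_linear => r x y; rewrite linearP.
by apply: realification_linear => r f h; rewrite add_lfunE scale_lfunE.
Qed.

(** The scalars are real, unlike those in [lfun_exp], so that real subspaces and real norms apply to
    each term. *)
Definition exp_term f k : E :=
  (k`!%:R : R)^-1 *: (iter k (comp_lfun f) \1%VF : E).

Lemma lfun_expE f : lfun_exp f =
  coord_lim (fun n => \sum_(k < n) exp_term f k : 'End(V)).
Proof.
rewrite -[LHS]/(coord_lim (fun n => \sum_(k < n) (k`!%:R)^-1 *:
  iter k (comp_lfun f) \1%VF)).
congr coord_lim; apply/funext => n; apply: eq_bigr => k _.
by rewrite /exp_term real_scaleE fmorphV rmorph_nat.
Qed.

Lemma exp_term_bounded : exists2 C, 0 < C & forall f k,
  vnorm (exp_term f k) <= vnorm (\1%VF : E) * exp_coeff (C * vnorm (f : E)) k.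
Proof.
have [C C0 CP] := comp_bounded; exists C => // f k.
rewrite /exp_term vnormZ ger0_norm ?invr_ge0// /exp_coeff/= mulrA [leRHS]mulrC.
rewrite ler_wpM2l ?invr_ge0//; elim: k => [|k IHk]; first by rewrite mulr1.
apply: le_trans (CP _ _) _; rewrite exprS mulrCA ler_wpM2l// mulr_ge0 ?vnorm_ge0//.
exact: ltW.
Qed.

Lemma exp_tends f :
  tends (fun n => \sum_(k < n) exp_term f k) (lfun_exp f : E).
Proof.
have [C C0 CP] := exp_term_bounded.
have [|l ul] := @tends_series R E (exp_term f) _ (CP f).
  rewrite (_ : series _ = fun n => vnorm (\1%VF : E) *
      series (exp_coeff (C * vnorm (f : E))) n).
    by apply: is_cvgMr; exact: is_cvg_series_exp_coeff.
  by apply/funext => n; rewrite /series/= mulr_sumr.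
by rewrite lfun_expE (coord_lim_tends ul).
Qed.

Lemma exp_tends_apply f (x : V) :
  @tends R (realification R V) (fun n => (\sum_(k < n) exp_term f k : 'End(V)) x)
    (lfun_exp f x).
Proof.
have := @tends_linear R E (realification R V) (fun f => (f : 'End(V)) x)
  _ _ _ (exp_tends f).
by apply; apply: realification_linear => r a b; rewrite add_lfunE scale_lfunE.
Qed.

Lemma exp_term_applyE f k (x : V) :
  exp_term f k x = (k`!%:R : R)^-1 *: (iter k f x : realification R V).
Proof.
rewrite /exp_term 2!real_scaleE lfunE/=; congr (_ *: _).
by elim: k => [|k /= <-]; rewrite ?lfunE//= ?lfunE.
Qed.

Lemma exp_sum_applyE f n (x : V) : (\sum_(k < n) exp_term f k : 'End(V)) x =
  \sum_(k < n) (exp_term f k : 'End(V)) x.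
Proof. by rewrite (@sum_lfunE _ V V). Qed.

(** [U] is only a real subspace: the partial sums have real coefficients and stay in [U], which is
    closed. This is how exponentials preserve [gR] and the images of [W]. *)
Lemma exp_stable f (U : {vspace realification R V}) :
  (forall x, x \in U -> (f x : realification R V) \in U) ->
  forall x, x \in U -> (lfun_exp f x : realification R V) \in U.
Proof.
move=> fU x xU; apply: tends_mem (exp_tends_apply f x) => n.
rewrite exp_sum_applyE; apply: (@rpred_sum (realification R V)) => k _.
rewrite exp_term_applyE memvZ//.
by elim: (k : nat) => // {}k; exact: fU.
Qed.

Lemma exp_fixed f x : f x = 0 -> lfun_exp f x = x.
Proof.
move=> fx0; apply: (@tends_unique R (realification R V) _ _ _
  (tends_shift 1 (exp_tends_apply f x))).
rewrite (_ : (fun _ => _) = fun=> x); first exact: tends_cst.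
apply/funext => n; rewrite exp_sum_applyE addn1 big_ord_recl/= exp_term_applyE/=.
rewrite fact0 invr1 scale1r big1 ?addr0// => k _.
rewrite exp_term_applyE iterSr fx0.
by rewrite (_ : iter _ _ _ = 0) ?scaler0//; elim: (k : nat) => //= j ->; rewrite linear0.
Qed.

(* Termwise, [f ^ k - h ^ k] is bounded by [k t ^ (k - 1)] times [f - h] up to a
   constant, where [t] bounds both norms. *)
Lemma exp_strict_differentiable : exists2 C, 0 < C & forall f h s,
  vnorm (f : E) <= s -> vnorm (h : E) <= s -> C * s <= 1 ->
  vnorm (lfun_exp f - lfun_exp h - (f - h) : E) <= C * s * vnorm (f - h : E).
Proof.
have [C C0 CP] := comp_bounded.
(* [K] is at least [C], so that [C * s <= 1], and at least [2 * C ^+ 2 * n1], the factor left after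
   summing the geometric bound. *)
pose n1 := vnorm (\1%VF : E); pose K := C * (1 + 2 * C * n1).
have n1_ge0 : 0 <= n1 by exact: vnorm_ge0.
have K_ge : C <= K by rewrite ler_peMr ?(ltW C0)// lerDl !mulr_ge0// ltW.
exists K => [|f h s fs hs Ks1]; first exact: lt_le_trans K_ge.
have s0 : 0 <= s by exact: le_trans (vnorm_ge0 _) fs.
have t0 : 0 <= C * s by rewrite mulr_ge0// ltW.
have t1 : C * s <= 1 by apply: le_trans Ks1; rewrite ler_wpM2r.
set d := vnorm (f - h : E); have d0 : 0 <= d by exact: vnorm_ge0.
pose p k : 'End(V) := iter k (comp_lfun h) \1%VF.
pose q k : 'End(V) := iter k (comp_lfun f) \1%VF.
have pP k : vnorm (p k : E) <= n1 * (C * s) ^+ k.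
  elim: k => [|k IHk]; first by rewrite mulr1.
  apply: le_trans (CP _ _) _; rewrite exprS mulrCA ler_pM ?mulr_ge0 ?vnorm_ge0 ?(ltW C0)//.
  by rewrite ler_pM2l.
pose b := C * n1 * d.
have b0 : 0 <= b by rewrite !mulr_ge0// ltW.
have qpP k : vnorm (q k.+1 - p k.+1 : E) <= k.+1%:R * (C * s) ^+ k * b.
  have qpE j : q j.+1 - p j.+1 = (f \o (q j - p j))%VF + ((f - h) \o p j)%VF.
    by rewrite /= comp_lfunDr comp_lfunDl !comp_lfunNl !comp_lfunNr addrA subrK.
  have stepP j : vnorm (q j.+1 - p j.+1 : E)
      <= C * s * vnorm (q j - p j : E) + (C * s) ^+ j * b.
    rewrite qpE; apply: le_trans (vnormD _ _) (lerD _ _).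
      apply: le_trans (CP _ _) _; rewrite ler_wpM2r ?vnorm_ge0//.
      by rewrite ler_pM2l.
    apply: le_trans (CP _ _) _.
    rewrite -/d (_ : _ * b = C * d * (n1 * (C * s) ^+ j)); last by rewrite /b; ring.
    by rewrite ler_wpM2l ?mulr_ge0// ltW.
  elim: k => [|k IHk].
    apply: le_trans (stepP 0%N) _.
    by rewrite /q /p/= subrr vnorm0 mulr0 add0r !mul1r.
  apply: le_trans (stepP _) _.
  rewrite (_ : k.+2%:R * _ * b = C * s * (k.+1%:R * (C * s) ^+ k * b)
    + (C * s) ^+ k.+1 * b); last by rewrite -[k.+2]add1n natrD exprS; ring.
  by rewrite lerD2r ler_wpM2l.
(* The factor [k.+2] cancels in the factorial, and [C * s <= 1] together with [2^k <= (k.+1)!]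
   bounds the rest. One factor [C * s] is kept: it is the smallness in the conclusion. *)
have termP k : vnorm (exp_term f k.+2 - exp_term h k.+2) <= C * s * b * 2^-1 ^+ k.
  rewrite /exp_term -scalerBr vnormZ ger0_norm ?invr_ge0//.
  rewrite -ler_pdivlMl ?invr_gt0 ?ltr0n ?fact_gt0// invrK.
  apply: le_trans (qpP k.+1) _.
  rewrite exprS factS natrM (_ : _ * _ * _ = k.+2%:R * (C * s * b * (C * s) ^+ k)); last by ring.
  rewrite -[leRHS]mulrA ler_wpM2l// [leRHS]mulrCA ler_wpM2l ?mulr_ge0 ?(ltW C0)//.
  apply: le_trans (_ : 1 <= _); first exact: exprn_ile1.
  rewrite exprVn ler_pdivlMr ?exprn_gt0// mul1r -natrX ler_nat.
  by elim: k => // k IHk; rewrite expnS factS leq_mul.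
have sumP n : \sum_(k < n) C * s * b * 2^-1 ^+ k <= 2 * (C * s * b).
  have half : \sum_(k < n) (2^-1 : R) ^+ k = 2 - 2 * 2^-1 ^+ n.
    elim: n => [|n IHn]; first by rewrite big_ord0 expr0; ring.
    by rewrite big_ord_recr/= IHn exprS; field.
  rewrite -mulr_sumr half mulrC ler_wpM2r ?mulr_ge0 ?(ltW C0)//.
  by rewrite gerBl mulr_ge0// exprn_ge0// invr_ge0.
(* Terms of order 0 cancel and those of order 1 give exactly [f - h], so only orders from 2 on
   contribute; hence the shift by 2. *)
apply: (@tends_le R E (fun n => \sum_(k < n + 2) exp_term f k
  - \sum_(k < n + 2) exp_term h k - (f - h))).
  apply: tendsB; last exact: tends_cst.
  exact: tendsB (tends_shift 2 (exp_tends f)) (tends_shift 2 (exp_tends h)).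
have e0 : exp_term f 0 - exp_term h 0 = 0 by rewrite /exp_term/= subrr.
have e1 : exp_term f 1 - exp_term h 1 = f - h :> E.
  by rewrite /exp_term/= invr1 !scale1r !comp_lfun1r.
move=> n; rewrite addn2 -sumrB 2!big_ord_recl [exp_term f _ - _]e0 add0r.
rewrite [exp_term f _ - _]e1 addrAC subrr add0r.
apply: le_trans (vnorm_sum _ _ _) _.
apply: le_trans (_ : \sum_(k < n) C * s * b * 2^-1 ^+ k <= _).
  by apply: ler_sum => k _; exact: (termP k).
apply: le_trans (sumP n) _.
rewrite /K /b (_ : 2 * _ = C * (2 * C * n1) * s * d); last by ring.
rewrite ler_wpM2r//; apply: ler_wpM2r => //.
by rewrite ler_wpM2l ?(ltW C0)// lerDr.
Qed.

End Exponential.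

(** * Cauchy products and exponentials of derivations *)

Lemma sum_triangle (V : nmodType) (q : nat -> nat -> V) n :
  \sum_(k < n) \sum_(i < k.+1) q i (k - i)%N =
  \sum_(i < n) \sum_(j < n | (i + j < n)%N) q i j.
Proof.
transitivity (\sum_(k < n) \sum_(i < n | (i <= k)%N) q i (k - i)%N).
  apply: eq_bigr => k _.
  rewrite (big_ord_widen_cond n xpredT (fun i => q i (k - i)%N)) ?ltn_ord//.
rewrite (exchange_big_dep xpredT)//=; apply: eq_bigr => i _.
rewrite -(big_mkord (fun k => (i <= k)%N) (fun k => q i (k - i)%N)).
rewrite -(big_mkord (fun j => (i + j < n)%N) (fun j => q i j)).
rewrite (big_cat_nat (leq0n i) (ltnW (ltn_ord i)))/= big_nat_cond big1 ?add0r; last first.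
  by move=> k /andP[/andP[_ ki]]; rewrite leqNgt ki.
rewrite -{1}[nat_of_ord i]add0n big_addn.
rewrite [RHS](big_cat_nat (leq0n (n - i)) (leq_subr i n))/=.
rewrite [X in _ = _ + X]big_nat_cond [X in _ = _ + X]big1 ?addr0; last first.
  by move=> k /andP[/andP[nik _]]; rewrite ltnNge -leq_subLR nik.
rewrite big_nat_cond [RHS]big_nat_cond; apply: eq_big => k.
  by rewrite leq_addl -ltn_subRL; case: (k < n - i)%N; rewrite ?andbF ?andbT.
by rewrite addnK.
Qed.

(* For the normalized terms, [i x_i = a x_(i-1)], so splitting
   [k+1 = i + (k+1-i)] replaces the binomial Leibniz formula. *)
Lemma leibniz_terms (R : realType) (U V W : lmodType R) (f : U -> V -> W)
    (a : U -> U) (b : V -> V) (c : W -> W) (x : nat -> U) (y : nat -> V) :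
  (forall u, linear (f u)) -> (forall v, linear (f^~ v)) -> linear c ->
  (forall u v, c (f u v) = f (a u) v + f u (b v)) ->
  (forall k, x k.+1 = k.+1%:R^-1 *: a (x k)) ->
  (forall k, y k.+1 = k.+1%:R^-1 *: b (y k)) ->
  forall k, \sum_(i < k.+2) f (x i) (y (k.+1 - i)%N) =
    k.+1%:R^-1 *: c (\sum_(i < k.+1) f (x i) (y (k - i)%N)).
Proof.
move=> fl fr cl cP xS yS k.
pose fL u := HB.pack_for {linear V -> W} (f u)
  (GRing.isLinear.Build R V W *:%R (f u) (fl u)).
pose fR v := HB.pack_for {linear U -> W} (f^~ v)
  (GRing.isLinear.Build R U W *:%R (f^~ v) (fr v)).
pose cL := HB.pack_for {linear W -> W} c
  (GRing.isLinear.Build R W W *:%R c cl).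
have fZl t u v : f (t *: u) v = t *: f u v := linearZ_LR (fR v) t u.
have fZr t u v : f u (t *: v) = t *: f u v := linearZ_LR (fL u) t v.
have aE i : a (x i) = i.+1%:R *: x i.+1.
  by rewrite xS scalerA divff ?scale1r.
have bE i : b (y i) = i.+1%:R *: y i.+1.
  by rewrite yS scalerA divff ?scale1r.
apply: (@scalerI _ _ k.+1%:R); first by rewrite pnatr_eq0.
rewrite scalerA divff ?pnatr_eq0// scale1r.
have -> : c (\sum_(i < k.+1) f (x i) (y (k - i)%N)) =
  \sum_(i < k.+1) c (f (x i) (y (k - i)%N)) := linear_sum cL _ _ _.
rewrite [RHS](eq_bigr (fun i : 'I_k.+1 => i.+1%:R *: f (x i.+1) (y (k - i)%N) +
   (k - i).+1%:R *: f (x i) (y (k - i).+1))); last first.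
  by move=> i _; rewrite cP aE bE fZl fZr.
rewrite big_split/= scaler_sumr.
rewrite (eq_bigr (fun i : 'I_k.+2 => i%:R *: f (x i) (y (k.+1 - i)%N) +
   (k.+1 - i)%:R *: f (x i) (y (k.+1 - i)%N))); last first.
  by move=> i _; rewrite -scalerDl -natrD subnKC// -ltnS.
rewrite big_split/= big_ord_recl scale0r add0r.
apply: (f_equal2 +%R).
  by apply: eq_bigr => i _; rewrite lift0 subSS.
rewrite big_ord_recr/= subnn scale0r addr0.
by apply: eq_bigr => i _; rewrite subSn// -ltnS.
Qed.

Section ExponentialOfDerivation.
Variable R : realType.

(** A case of the binomial theorem, obtained from [leibniz_terms] with multiplications by [t], [t]
    and [t + t] as the three operators. *)
Lemma exp_coeff_leibniz (t : R) k :
  \sum_(i < k.+1) exp_coeff t i * exp_coeff t (k - i)%N = exp_coeff (t + t) k.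
Proof.
have coefS (s : R) j : exp_coeff s j.+1 = j.+1%:R^-1 * (s * exp_coeff s j).
  by rewrite /exp_coeff/= factS natrM invfM exprS; ring.
elim: k => [|k IHk].
  by rewrite big_ord1 /exp_coeff/= !expr0 fact0; field.
rewrite (@leibniz_terms R R^o R^o R^o *%R ( *%R t) ( *%R t) ( *%R (t + t))) ?IHk.
- by rewrite coefS.
- by move=> u r x y; rewrite mulrDr scalerAr.
- by move=> u r x y /=; rewrite mulrDl scalerAl.
- by move=> r x y; rewrite mulrDr scalerAr.
- by move=> u v; rewrite mulrDl mulrA [u * (t * v)]mulrCA mulrA.
- by move=> j; rewrite coefS.
- by move=> j; rewrite coefS.
Qed.

(** The square of the partial sums minus the triangle [i + j < n] is a difference of partial sums
    for [expR t * expR t] and [expR (t + t)]. This is the majorant for [exp_derivation_lie]. *)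
Lemma cauchy_product_defect (t : R) :
  (fun n => \sum_(i < n) \sum_(j < n | (n <= i + j)%N) exp_coeff t i * exp_coeff t j)
  @ \oo --> (0 : R).
Proof.
rewrite (_ : (fun _ => _) = fun n => series (exp_coeff t) n * series (exp_coeff t) n
    - series (exp_coeff (t + t)) n).
  rewrite [0 in X in _ --> X](_ : 0 = expR t * expR t - expR (t + t)); last first.
    by rewrite expRD subrr.
  have cvg_exp (s : R) : series (exp_coeff s) @ \oo --> expR s.
    exact: is_cvg_series_exp_coeff.
  by apply: cvgB => //; apply: cvgM.
apply/funext => n; rewrite /series/= !big_mkord.
under [X in _ = _ - X]eq_bigr do rewrite -exp_coeff_leibniz.
rewrite (sum_triangle (fun i j => exp_coeff t i * exp_coeff t j)).
rewrite mulr_suml -sumrB; apply: eq_bigr => i _.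
rewrite mulr_sumr [X in _ = X - _](bigID (fun j : 'I_n => (i + j < n)%N))/=.
rewrite addrAC subrr add0r; apply: eq_bigl => j; by rewrite -leqNgt.
Qed.

Variables (g : lieAlgType R[i]) (D : 'End(g)).
Local Notation gr := (realification R g).

Lemma real_lie_linearr (x : gr) : linear (lie x : gr -> gr).
Proof. by move=> r y z; exact: (lie_bilinear (s := gr)).2. Qed.

Lemma real_lie_linearl (y : gr) : linear ((fun x => lie x y) : gr -> gr).
Proof. by move=> r x z; exact: (lie_bilinear (s := gr)).1. Qed.

Hypothesis D_derivation : forall x y, D (lie x y) = lie (D x) y + lie x (D y).

(** By the Leibniz rule the left side is a limit of sums over triangles, the right side a limit of
    sums over squares. The bracket is bounded, so their difference is dominated by
    [cauchy_product_defect]. *)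
Lemma exp_derivation_lie (x y : g) :
  lfun_exp D (lie x y) = lie (lfun_exp D x) (lfun_exp D y).
Proof.
pose z (u : g) k : gr := (k`!%:R : R)^-1 *: (iter k D u : gr).
pose S (u : g) n : gr := (\sum_(k < n) exp_term D k : 'End(g)) u.
have SE u n : S u n = \sum_(k < n) z u k.
  rewrite /S exp_sum_applyE; apply: eq_bigr => k _; exact: exp_term_applyE.
have zS u k : z u k.+1 = k.+1%:R^-1 *: (D (z u k) : gr).
  rewrite /z factS natrM invfM -scalerA; congr (_ *: _).
  by rewrite [in RHS]real_scaleE linearZ.
have lieE k : \sum_(i < k.+1) (lie (z x i) (z y (k - i)%N) : gr) = z (lie x y) k.
  elim: k => [|k IHk]; first by rewrite big_ord1 /z fact0 invr1 !scale1r.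
  rewrite (@leibniz_terms R gr gr gr lie D D D) ?IHk ?zS//.
  - exact: real_lie_linearr.
  - exact: real_lie_linearl.
  - by move=> r u v; exact: (linearP D r%:C%C).
have [C C0 CP] := lfun_apply_bounded g.
have [C1 C10 C1P] := exp_term_bounded g.
have [C2 C20 C2P] := bilinear_bounded real_lie_linearr real_lie_linearl.
pose t := C1 * vnorm (D : realification R 'End(g)).
pose A (u : g) := C * vnorm (\1%VF : realification R 'End(g)) * vnorm (u : gr).
have A0 u : 0 <= A u by rewrite !mulr_ge0 ?vnorm_ge0// ltW.
have zP u k : vnorm (z u k) <= A u * exp_coeff t k.
  rewrite /z -exp_term_applyE; apply: le_trans (CP _ _) _.
  rewrite [leRHS]mulrAC ler_wpM2r ?vnorm_ge0// -mulrA ler_wpM2l ?C1P//.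
  exact: ltW.
have lS : tends (fun n => (lie (S x n) (S y n) : gr) - S (lie x y) n)
    ((lie (lfun_exp D x) (lfun_exp D y) : gr) - lfun_exp D (lie x y)).
  apply: tendsB; last exact: exp_tends_apply.
  apply: tends_bilinear real_lie_linearr real_lie_linearl _ _; exact: exp_tends_apply.
apply/esym/eqP; rewrite -subr_eq0; apply/eqP.
apply: tends_unique lS _; apply: (@tends_squeeze _ _ _ _
  (fun n => C2 * A x * A y * \sum_(i < n) \sum_(j < n | (n <= i + j)%N)
     exp_coeff t i * exp_coeff t j)) => [n|]; last first.
  by rewrite -[0 in X in _ --> X](mulr0 (C2 * A x * A y)); apply: cvgMr; exact: cauchy_product_defect.
rewrite subr0 [X in _ - X]SE.
rewrite [X in _ - X](_ : _ = \sum_(k < n) \sum_(i < k.+1) (lie (z x i) (z y (k - i)%N) : gr)); last first.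
  by apply: eq_bigr => k _; rewrite lieE.
rewrite (sum_triangle (fun i j => lie (z x i) (z y j) : gr)).
rewrite [X in X - _](_ : _ = \sum_(i < n) \sum_(j < n) (lie (z x i) (z y j) : gr)); last first.
  rewrite !SE.
  pose fL u := HB.pack_for {linear gr -> gr} (lie u : gr -> gr)
    (GRing.isLinear.Build R gr gr *:%R (lie u : gr -> gr) (real_lie_linearr u)).
  pose fR v := HB.pack_for {linear gr -> gr} ((fun u => lie u v) : gr -> gr)
    (GRing.isLinear.Build R gr gr *:%R ((fun u => lie u v) : gr -> gr) (real_lie_linearl v)).
  rewrite -[lie _ _]/(fR (\sum_(k < n) z y k) _) linear_sum; apply: eq_bigr => i _ /=.
  by rewrite -[lie _ _]/(fL (z x i) _) linear_sum.
rewrite -sumrB mulr_sumr; apply: le_trans (vnorm_sum _ _ _) (ler_sum _ _) => i _.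
rewrite [X in X - _](bigID (fun j : 'I_n => (i + j < n)%N))/= addrAC subrr add0r.
rewrite mulr_sumr; apply: le_trans (vnorm_sum _ _ _) _.
rewrite (eq_bigl (fun j : 'I_n => (n <= i + j)%N)); last by move=> j; rewrite -leqNgt.
apply: ler_sum => j _; apply: le_trans (C2P _ _) _.
rewrite (_ : _ * (_ * _) = C2 * (A x * exp_coeff t i) * (A y * exp_coeff t j)); last by ring.
by rewrite ler_pM ?mulr_ge0 ?vnorm_ge0 ?(ltW C20)// ler_wpM2l ?(ltW C20).
Qed.

End ExponentialOfDerivation.

(** * The adjoint group near the identity *)

Section LieTrace.
Variables (F : fieldType) (g : lieAlgType F).
Implicit Types (x y z : g) (f h : 'End(g)).
Local Notation b := (vbasis {:g}).

Lemma lftraceP a f h : lftrace (a *: f + h) = a * lftrace f + lftrace h.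
Proof.
rewrite /lftrace mulr_sumr -big_split; apply: eq_bigr => i _ /=.
by rewrite add_lfunE scale_lfunE linearP.
Qed.

Lemma lftraceD f h : lftrace (f + h) = lftrace f + lftrace h.
Proof. by rewrite -[f in LHS]scale1r lftraceP mul1r. Qed.

Lemma lftrace0 : lftrace (0 : 'End(g)) = 0.
Proof. by apply: (addrI (lftrace (0 : 'End(g)))); rewrite -lftraceD !addr0. Qed.

Lemma lftraceN f : lftrace (- f) = - lftrace f.
Proof. by apply/eqP; rewrite -addr_eq0 -lftraceD addNr lftrace0. Qed.

Lemma lftraceC f h : lftrace (f \o h)%VF = lftrace (h \o f)%VF.
Proof.
have trE (p q : 'End(g)) : lftrace (p \o q)%VF =
    \sum_(i < \dim {:g}) \sum_(j < \dim {:g}) coord b j (q b`_i) * coord b i (p b`_j).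
  apply: eq_bigr => i _; rewrite comp_lfunE.
  rewrite {1}(coord_vbasis (memvf (q b`_i))) !linear_sum; apply: eq_bigr => j _.
  by rewrite !linearZ.
rewrite !trE exchange_big; apply: eq_bigr => i _; apply: eq_bigr => j _.
exact: mulrC.
Qed.

Lemma ad_is_linear : linear (@ad F g).
Proof.
move=> a x y; apply/lfunP => z; rewrite add_lfunE scale_lfunE !adE.
exact: (lie_bilinear (s := g)).1.
Qed.
HB.instance Definition _ := GRing.isLinear.Build F g 'End(g) *:%R (@ad F g) ad_is_linear.

Lemma lieN x y : lie x (- y) = - lie x y.
Proof. by rewrite -!adE linearN. Qed.

Lemma lieC x y : lie x y = - lie y x.
Proof.
apply/eqP; rewrite -addr_eq0; apply/eqP.
have := liexx (x + y); rewrite -adE [ad (x + y)]linearD add_lfunE !linearD /= !adE !liexx.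
by rewrite add0r addr0 addrC.
Qed.

Lemma ad_lie x y : ad (lie x y) = (ad x \o ad y)%VF - (ad y \o ad x)%VF.
Proof.
apply/lfunP => z; rewrite add_lfunE opp_lfunE !comp_lfunE !adE.
have /eqP := lie_jacobi x y z; rewrite addr_eq0 [lie z (lie x y)]lieC opprK => /eqP <-.
by rewrite [lie z x]lieC lieN.
Qed.

Lemma hom_ad f x : (forall x y, f (lie x y) = lie (f x) (f y)) ->
  (f \o ad x)%VF = (ad (f x) \o f)%VF.
Proof. by move=> fP; apply/lfunP => y; rewrite !comp_lfunE !adE. Qed.

Hypothesis killing_nondeg : forall x, (forall y, killing x y = 0) -> x = 0.

(* The projection of ['End(g)] onto [ad g] along the orthogonal of [ad g] for
   the trace form. *)
Lemma ad_projection : exists P : {linear 'End(g) -> g},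
  (forall f y, killing (P f) y = lftrace (f \o ad y)%VF) /\ forall x, P (ad x) = x.
Proof.
(* [k f] stores the functional sending [y] to the trace of [f \o ad y] by its values on a basis. On
   [ad g] this is the Killing form, so [T], which is [k] after [ad], is injective, and [P] is [k]
   followed by the inverse of [T]. *)
pose k f : g := \sum_(i < \dim {:g}) lftrace (f \o ad b`_i)%VF *: b`_i.
have k_linear : linear k.
  move=> a f h; rewrite /k scaler_sumr -big_split; apply: eq_bigr => i _ /=.
  by rewrite scalerA -scalerDl -lftraceP comp_lfunDl comp_lfunZl.
pose kL := HB.pack_for {linear 'End(g) -> g} k
  (GRing.isLinear.Build F 'End(g) g *:%R k k_linear).
have lftrace_ad f h : k f = k h -> forall y, lftrace (f \o ad y)%VF = lftrace (h \o ad y)%VF.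
  move=> kfh y.
  have kE p i : coord b i (k p) = lftrace (p \o ad b`_i)%VF.
    by rewrite coord_sum_free// (basis_free (vbasisP _)).
  pose tr p (y : g) : F^o := lftrace (p \o ad y)%VF.
  have tr_linear p : linear (tr p).
    move=> a u v; rewrite /tr linearP comp_lfunDr -comp_lfunZr; exact: lftraceP.
  pose trL p := HB.pack_for {linear g -> F^o} (tr p)
    (GRing.isLinear.Build F g F^o *:%R (tr p) (tr_linear p)).
  rewrite (coord_vbasis (memvf y)) -[LHS]/(trL f _) -[RHS]/(trL h _) !linear_sum; apply: eq_bigr => i _.
  by rewrite !linearZ /= /tr -!kE kfh.
pose T : 'End(g) := linfun (kL \o @ad F g).
have TE x : T x = k (ad x) by rewrite lfunE.
have T_inj : lker T == 0%VS.
  apply/lker0P => x y; rewrite !TE => /lftrace_ad kxy.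
  apply/eqP; rewrite -subr_eq0; apply/eqP/killing_nondeg => z.
  have := lftraceP (-1) (ad y \o ad z)%VF (ad x \o ad z)%VF.
  rewrite -kxy mulN1r addNr => <-; congr lftrace.
  by rewrite [RHS]addrC scaleN1r [ad _]linearB comp_lfunDl comp_lfunNl.
exists ((T^-1)%VF \o kL)%FUN; split=> [f y|x] /=.
  by apply: lftrace_ad; rewrite -TE lker0_lfunVK.
by rewrite -TE lker0_lfunK.
Qed.

End LieTrace.

(** * Contraction principle, and homomorphisms near the identity *)

Lemma contraction_fixpoint (R : realType) (V : vectType R) (T : V -> V) s :
  0 <= s -> (forall z, vnorm z <= s -> vnorm (T z) <= s) ->
  (forall z w, vnorm z <= s -> vnorm w <= s ->
     vnorm (T z - T w) <= 2^-1 * vnorm (z - w)) ->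
  exists2 z, vnorm z <= s & T z = z.
Proof.
move=> s0 Ts Tc; pose u n := iter n T 0.
have us n : vnorm (u n) <= s by elim: n => [|n IHn]; [rewrite vnorm0|exact: Ts].
have duP k : vnorm (u k.+1 - u k) <= geometric s 2^-1 k.
  elim: k => [|k IHk]; first by rewrite subr0 /= mulr1; exact: (us 1%N).
  apply: le_trans (Tc (u k.+1) (u k) (us _) (us _)) _.
  by rewrite /= exprS mulrCA ler_pM2l// invr_gt0.
have [|l ul] := tends_series duP.
  by apply: is_cvg_geometric_series; rewrite ger0_norm ?invr_ge0// invf_lt1// ltr1n.
have {}ul : tends u l.
  rewrite (_ : u = fun n => \sum_(k < n) (u k.+1 - u k))//.
  apply/funext; elim=> [|n IHn]; first by rewrite big_ord0.
  by rewrite big_ord_recr/= -IHn addrC subrK.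
have ls : vnorm l <= s := tends_le ul us.
exists l => //; apply: (@tends_unique _ _ (fun n => u (n + 1)%N)); last exact: tends_shift.
apply: (@tends_squeeze _ _ _ _ (fun n => 2^-1 * vnorm (u n - l))) => [n|].
  by rewrite addn1; exact: Tc.
by rewrite -[0 in X in _ --> X](mulr0 2^-1); exact: cvgMr.
Qed.

Section LocalInverse.
Variables (R : realType) (g : lieAlgType R[i]).
Local Notation gr := (realification R g).
Local Notation E := (realification R 'End(g)).
Implicit Types (x y z : g) (f h : 'End(g)).

(** Passes from a pointwise bound to the coordinate norm of ['End(g)], by writing [f] as the sum of
    the maps [coord b i y *: f b_i]. *)
Lemma lfun_norm_le : exists2 C, 0 < C & forall f M, 0 <= M ->
  (forall x, vnorm (f x : gr) <= M * vnorm (x : gr)) -> vnorm (f : E) <= C * M.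
Proof.
pose b := vbasis {:g}.
pose e i (v : g) : 'End(g) := linfun (fun y : g => coord b i y *: v).
have eE i v y : e i v y = coord b i y *: v.
  have lin : linear (fun y : g => coord b i y *: v).
    by move=> a y1 y2; rewrite linearP scalerDl scalerA.
  exact: (lfunE (HB.pack_for {linear g -> g} (fun y : g => coord b i y *: v)
    (GRing.isLinear.Build _ g g *:%R _ lin))).
have /choice[C CP] (i : 'I_(\dim {:g})) : exists C, 0 < C /\
    forall v : gr, vnorm (e i v : E) <= C * vnorm v.
  have [|C ? ?] := @linear_bounded R gr E (e i); last by exists C.
  apply: realification_linear => a v w; apply/lfunP => y.
  by rewrite add_lfunE scale_lfunE !eE scalerDr !scalerA mulrC.
have C0 i : 0 <= C i by have [/ltW] := CP i.
exists (1 + \sum_i C i * vnorm (b`_i : gr)) => [|f M M0 fM].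
  by rewrite ltr_pwDl// sumr_ge0// => i _; rewrite mulr_ge0// vnorm_ge0.
have -> : f = \sum_i e i (f b`_i).
  apply/lfunP => y; rewrite sum_lfunE {1}(coord_vbasis (memvf y)) linear_sum.
  by apply: eq_bigr => i _; rewrite linearZ eE.
apply: le_trans (@vnorm_sum R E _ _ _ _) _; rewrite mulrDl mul1r mulr_suml ler_wpDl//.
apply: ler_sum => i _; have [_ /(_ (f b`_i)) efP] := CP i; apply: le_trans efP _.
by rewrite -mulrA ler_wpM2l// mulrC.
Qed.

Lemma real_ad_bounded : exists2 C, 0 < C & forall x,
  vnorm (ad x : E) <= C * vnorm (x : gr).
Proof.
have [|C C0 CP] := @linear_bounded R gr E (@ad _ g); last by exists C.
exact: realification_linear (@ad_is_linear _ g).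
Qed.

Variable P : {linear 'End(g) -> g}.

Lemma real_P_bounded : exists2 C, 0 < C & forall f,
  vnorm (P f : gr) <= C * vnorm (f : E).
Proof.
have [|C C0 CP] := @linear_bounded R E gr P; last by exists C.
apply: realification_linear; exact: linearP.
Qed.

Section Uniqueness.
Hypothesis killing_nondeg : forall x, (forall y, killing x y = 0) -> x = 0.
Hypothesis PE : forall f y, killing (P f) y = lftrace (f \o ad y)%VF.

(** A nonlinear form of the fact that a derivation killed by [P] is zero. For [A = f - h] the
    homomorphism identities give [ad (A x) = [A, ad x] - Q], where each term of [Q] is linear in [A]
    and in [f - 1] or [h - 1]. Against [ad y] the commutator has trace [tr (A ad [x, y]) = killing
    (P A) [x, y] = 0]. So [A x = - P Q], which near the identity forces [A = 0]. *)
Lemma hom_unique_near1 : exists2 e, 0 < e & forall f h,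
  (forall x y, f (lie x y) = lie (f x) (f y)) ->
  (forall x y, h (lie x y) = lie (h x) (h y)) ->
  vnorm (f - \1%VF : E) < e -> vnorm (h - \1%VF : E) < e -> P f = P h -> f = h.
Proof.
have [C1 C10 C1P] := lfun_norm_le; have [C2 C20 C2P] := real_ad_bounded.
have [C3 C30 C3P] := real_P_bounded; have [C4 C40 C4P] := comp_bounded g.
have [C5 C50 C5P] := lfun_apply_bounded g.
(* The final estimate is [vnorm A <= K * a * vnorm A], with [a] the sum of the distances of [f] and
   [h] to the identity; distances below [(2 * K)^-1] give [K * a < 1]. *)
pose K := C1 * (C3 * C4 * C2 * C5).
have K0 : 0 < K by rewrite !mulr_gt0.
have e0 : 0 < (2 * K)^-1 by rewrite invr_gt0 mulr_gt0.
exists (2 * K)^-1 => // f h f_hom h_hom fe he Pfh.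
pose A := f - h.
have adA x : (A \o ad x)%VF = ad (A x) + (ad x \o A)%VF +
    ((ad (A x) \o (f - \1))%VF + (ad ((h - \1)%VF x) \o A)%VF).
  rewrite [in LHS]/A comp_lfunDl comp_lfunNl !hom_ad//.
  have -> : f x = A x + h x by rewrite /A add_lfunE opp_lfunE subrK.
  have hE : h x = (h - \1)%VF x + x by rewrite add_lfunE opp_lfunE id_lfunE subrK.
  rewrite [ad (A x + h x)]linearD /= comp_lfunDl.
  rewrite -addrA -comp_lfunNr -comp_lfunDr -/A.
  rewrite hE [ad (_ + x)]linearD comp_lfunDl.
  have {1}-> : f = \1%VF + (f - \1%VF) by rewrite addrC subrK.
  rewrite comp_lfunDr comp_lfun1r -!addrA; congr (_ + _).
  by rewrite addrA addrC.
have AP x : A x = - P ((ad (A x) \o (f - \1))%VF + (ad ((h - \1)%VF x) \o A)%VF).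
  apply/eqP; rewrite -subr_eq0 opprK; apply/eqP/killing_nondeg => y.
  set Q := (X in P X).
  have AyE : (A \o ad x \o ad y)%VF = (ad (A x) \o ad y)%VF
      + ((ad x \o A \o ad y)%VF + (Q \o ad y)%VF).
    by rewrite adA !comp_lfunDl -addrA.
  have PA : lftrace (A \o ad (lie x y))%VF = 0.
    rewrite -PE /A linearB Pfh subrr /killing [ad 0]linear0 comp_lfun0l.
    exact: lftrace0.
  have trC : lftrace (A \o ad x \o ad y)%VF = lftrace (ad x \o A \o ad y)%VF.
    rewrite -[RHS]addr0 -PA ad_lie comp_lfunDr comp_lfunNr lftraceD lftraceN !comp_lfunA.
    by rewrite -[(ad x \o A \o ad y)%VF]comp_lfunA [lftrace (ad x \o _)]lftraceC addrCA subrr addr0.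
  have := congr1 lftrace AyE; rewrite !lftraceD trC -(PE Q) => /eqP.
  rewrite addrCA -[X in X == _]addr0 (inj_eq (addrI _)) eq_sym => /eqP <-.
  by rewrite /killing [ad (A x + P Q)]linearD /= comp_lfunDl lftraceD.
have AM x : vnorm (A x : gr) <= C3 * C4 * C2 * C5 *
    (vnorm (f - \1%VF : E) + vnorm (h - \1%VF : E)) * vnorm (A : E) * vnorm (x : gr).
  rewrite AP [leLHS](@vnormN R gr).
  apply: le_trans (C3P _) _.
  rewrite -!mulrA ler_pM2l//; apply: le_trans (@vnormD R E _ _) _.
  have adP (z : 'End(g)) : vnorm (ad (z x) : E) <= C2 * (C5 * vnorm (z : E) * vnorm (x : gr)).
    by apply: le_trans (C2P _) _; rewrite ler_pM2l.
  apply: le_trans (lerD (C4P _ _) (C4P _ _)) _.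
  rewrite -!mulrA -mulrDr ler_pM2l//.
  rewrite [leRHS](_ : _ =
      C2 * (C5 * vnorm (A : E) * vnorm (x : gr)) * vnorm (f - \1%VF : E) +
      C2 * (C5 * vnorm (h - \1%VF : E) * vnorm (x : gr)) * vnorm (A : E)); last by ring.
  by apply: lerD; rewrite ler_wpM2r ?vnorm_ge0//; exact: adP.
set a := vnorm (f - \1%VF : E) + vnorm (h - \1%VF : E) in AM.
have a0 : 0 <= a by rewrite addr_ge0 ?vnorm_ge0.
have aK : K * a < 1.
  rewrite mulrC -ltr_pdivlMr// mul1r (_ : K^-1 = (2 * K)^-1 + (2 * K)^-1).
    exact: ltrD.
  by field; exact: lt0r_neq0.
have /C1P/(_ AM) AK : 0 <= C3 * C4 * C2 * C5 * a * vnorm (A : E).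
  by rewrite !mulr_ge0 ?vnorm_ge0// ltW.
apply/eqP; rewrite -subr_eq0; apply/eqP/(@vnorm_eq0 R E)/eqP.
rewrite eq_le vnorm_ge0 andbT leNgt; apply/negP => A0.
have : K * a * vnorm (A : E) < vnorm (A : E) by rewrite gtr_pMl.
by rewrite ltNge (le_trans AK)// /K !mulrA.
Qed.
End Uniqueness.

(* [z] is the sum of its components in [U1] and [U2], so
   [P (exp (ad z1) exp (ad z2)) - P 1 - z] has small Lipschitz constant near [0],
   and the contraction principle applies. *)
Lemma exp_product_surjective_near1 (U1 U2 : {vspace gr}) e :
  (forall x, P (ad x) = x) -> (U1 + U2)%VS = fullv -> 0 < e ->
  exists2 d, 0 < d & forall v : g, vnorm (v - P \1%VF : gr) < d ->
    exists x y : g, [/\ (x : gr) \in U1, (y : gr) \in U2,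
      P (lfun_exp (ad x) \o lfun_exp (ad y))%VF = v &
      vnorm ((lfun_exp (ad x) \o lfun_exp (ad y))%VF - \1%VF : E) < e].
Proof.
move=> PK U12 e0.
have [C2 C20 C2P] := real_ad_bounded.
have [C3 C30 C3P] := real_P_bounded; have [C4 C40 C4P] := comp_bounded g.
have [C6 C60 C6P] := exp_strict_differentiable g.
pose p1 : 'End(gr) := addv_pi1 U1 U2; pose p2 : 'End(gr) := addv_pi2 U1 U2.
have p12 (z : gr) : p1 z + p2 z = z by apply: addv_pi1_pi2; rewrite U12 memvf.
have [c1 c10 c1P] := linear_bounded (fun r => linearP p1 r).
have [c2 c20 c2P] := linear_bounded (fun r => linearP p2 r).
pose c := C2 * (c1 + c2); have c0 : 0 < c by rewrite mulr_gt0// addr_gt0.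
pose ex (p : 'End(gr)) (z : gr) : 'End(g) := lfun_exp (ad (p z : g)).
have adP p (z : gr) : p = p1 \/ p = p2 -> vnorm (ad (p z : g) : E) <= c * vnorm z.
  move=> pE; apply: le_trans (C2P _) _; rewrite -mulrA ler_pM2l//.
  case: pE => ->; [apply: le_trans (c1P z) _|apply: le_trans (c2P z) _];
    by rewrite ler_wpM2r ?vnorm_ge0// ?lerDl ?lerDr ltW.
pose u (p : 'End(gr)) (z : gr) : 'End(g) := ex p z - \1%VF.
(* [K] collects two errors of strict differentiability and two cross terms of the product, each with
   factor [4 * C4 * c ^+ 2]. [M] collects the sizes of [u p1 z], [u p2 z] and their composite. *)
pose K := C3 * (2 * C6 * c ^+ 2 + 8 * C4 * c ^+ 2).
pose M := 4 * c + 4 * C4 * c ^+ 2.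
have c20' : 0 < c ^+ 2 by rewrite exprn_gt0.
have K0 : 0 < K by apply: mulr_gt0 => //; apply: addr_gt0; do 2?[apply: mulr_gt0 => //].
have M0 : 0 < M by apply: addr_gt0; do 2?[apply: mulr_gt0 => //].
(* The summands secure in turn [s <= 1], the range of [exp_strict_differentiable], the contraction
   factor [2^-1], and a product within [e] of the identity. *)
pose s := (1 + C6 * c + 2 * K + 2 * M / e)^-1.
have C6c0 : 0 < C6 * c by exact: mulr_gt0.
have Me0 : 0 < 2 * M / e by rewrite divr_gt0// mulr_gt0.
have den0 : 0 < 1 + C6 * c + 2 * K + 2 * M / e by lra.
have s0 : 0 < s by rewrite invr_gt0.
have [s1 sC sK sM] : [/\ s <= 1, C6 * (c * s) <= 1, K * s <= 2^-1 & s * M < e].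
  have sE : s * 1 + s * (C6 * c) + s * (2 * K) + s * (2 * M / e) = 1.
    by rewrite -!mulrDr mulVf// gt_eqF.
  have h1 : 0 < s * (C6 * c) by exact: mulr_gt0.
  have h2 : 0 < s * (2 * K) by apply: mulr_gt0 => //; exact: mulr_gt0.
  have h3 : 0 < s * (2 * M / e) by exact: mulr_gt0.
  have h4 : s * M / e = s * (2 * M / e) / 2 by field; exact: lt0r_neq0.
  clear -sE h1 h2 h3 h4 s0 e0 M0; split; [lra|lra|lra|].
  by rewrite -[ltRHS]mul1r -ltr_pdivrMr// h4; lra.
have strict p (z w : gr) : p = p1 \/ p = p2 -> vnorm z <= s -> vnorm w <= s ->
    vnorm (u p z - u p w - ad (p (z - w) : g) : E) <= C6 * c ^+ 2 * s * vnorm (z - w).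
  move=> pE zs ws.
  have -> : u p z - u p w = ex p z - ex p w by rewrite /u opprB addrA subrK.
  have adB : ad (p (z - w) : g) = ad (p z : g) - ad (p w : g).
    rewrite [p (z - w)](raddfB p).
    exact: (raddfB (@ad _ g) (p z : g) (p w : g)).
  rewrite adB; apply: le_trans (C6P _ _ (c * s) _ _ sC) _.
  - by apply: le_trans (adP _ _ pE) _; rewrite ler_pM2l.
  - by apply: le_trans (adP _ _ pE) _; rewrite ler_pM2l.
  rewrite -adB; apply: le_trans (_ : C6 * (c * s) * (c * vnorm (z - w)) <= _).
    apply: ler_wpM2l; last exact: adP.
    by apply: mulr_ge0; [exact: ltW|rewrite mulr_ge0// ltW].
  by rewrite le_eqVlt; apply/orP; left; apply/eqP; ring.
have u_lip p (z w : gr) : p = p1 \/ p = p2 -> vnorm z <= s -> vnorm w <= s ->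
    vnorm (u p z - u p w : E) <= 2 * c * vnorm (z - w).
  move=> pE zs ws; rewrite -[u p z - u p w](subrK (ad (p (z - w) : g))).
  apply: le_trans (@vnormD R E _ _) _.
  apply: le_trans (lerD (strict _ _ _ pE zs ws) (adP _ _ pE)) _.
  rewrite -mulrDl ler_wpM2r ?vnorm_ge0//.
  have : c * (C6 * (c * s)) <= c * 1 by rewrite ler_pM2l.
  by rewrite (_ : C6 * c ^+ 2 * s = c * (C6 * (c * s))); [lra|ring].
have u0 p : u p 0 = 0.
  apply/eqP; rewrite subr_eq0; apply/eqP/lfunP => x.
  have ad0 : ad (p 0 : g) = 0 by rewrite [p 0](raddf0 p); exact: (raddf0 (@ad _ g)).
  by rewrite /ex exp_fixed ?id_lfunE// ad0 lfunE.
have u_le (p : 'End(gr)) (z : gr) : p = p1 \/ p = p2 -> vnorm z <= s -> vnorm (u p z : E) <= 2 * c * s.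
  move=> pE zs; have := u_lip p z 0 pE zs; rewrite vnorm0 u0 !subr0 => /(_ (ltW s0)) uz.
  by apply: le_trans uz _; rewrite ler_pM2l// mulr_gt0.
have e1 : p1 = p1 \/ p1 = p2 by left.
have e2 : p2 = p1 \/ p2 = p2 by right.
have exE (p : 'End(gr)) (z : gr) : lfun_exp (ad (p z : g)) = \1%VF + u p z by rewrite addrC subrK.
clearbody u; pose f (z : gr) : 'End(g) := ((\1 + u p1 z) \o (\1 + u p2 z))%VF.
have fE (z : gr) : f z = \1%VF + (u p1 z + u p2 z + (u p1 z \o u p2 z)%VF).
  by rewrite /f comp_lfunDr comp_lfun1r comp_lfunDl comp_lfun1l !addrA.
have fM (z : gr) : vnorm z <= s -> vnorm (f z - \1%VF : E) <= s * M.
  move=> zs; rewrite fE addrC addKr.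
  apply: le_trans (@vnormD R E _ _) _.
  apply: le_trans (lerD (@vnormD R E _ _) (C4P _ _)) _.
  have uc1 := u_le _ _ e1 zs; have uc2 := u_le _ _ e2 zs.
  have ucc : C4 * vnorm (u p1 z : E) * vnorm (u p2 z : E) <= C4 * (2 * c * s) * (2 * c * s).
    by rewrite ler_pM ?mulr_ge0 ?vnorm_ge0 ?(ltW C40)// ler_pM2l.
  have : C4 * (2 * c * s) * (2 * c * s) <= 4 * C4 * c ^+ 2 * s.
    rewrite (_ : _ * _ * _ = 4 * C4 * c ^+ 2 * s * s); last by ring.
    by rewrite ger_pMr// mulr_gt0// mulr_gt0// mulr_gt0.
  by rewrite /M mulrDr; clear -uc1 uc2 ucc; lra.
have fB (z w : gr) : vnorm z <= s -> vnorm w <= s ->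
    vnorm (z - w - (P (f z - f w) : gr)) <= 2^-1 * vnorm (z - w).
  move=> zs ws; pose a1 := ad (p1 (z - w) : g); pose a2 := ad (p2 (z - w) : g).
  have zwE : z - w = (P (a1 + a2) : gr).
    by rewrite linearD !PK; exact/esym/p12.
  rewrite {1}zwE (_ : _ - _ = P (a1 + a2 - (f z - f w)) :> gr); last exact/esym/(raddfB P).
  apply: le_trans (C3P _) _; rewrite [vnorm _](@vnormBC R E).
  have -> : f z - f w - (a1 + a2) = (u p1 z - u p1 w - a1) + (u p2 z - u p2 w - a2)
      + (((u p1 z - u p1 w) \o u p2 z)%VF + (u p1 w \o (u p2 z - u p2 w))%VF).
    rewrite !fE [X in _ = _ + X](_ : _ = (u p1 z \o u p2 z)%VF - (u p1 w \o u p2 w)%VF); last first.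
      by rewrite comp_lfunDl comp_lfunNl comp_lfunDr comp_lfunNr addrA subrK.
    have addB6 (V : zmodType) (a b e' a' b' e1' v1 v2 : V) :
        a + b + e' - (a' + b' + e1') - (v1 + v2) = (a - a' - v1) + (b - b' - v2) + (e' - e1').
      rewrite [- (_ + e1')]opprD [a + b + e' + _]addrACA [- (a' + b')]opprD.
      by rewrite [a + b + _]addrACA [LHS]addrAC [- (v1 + v2)]opprD [a - a' + (b - b') + _]addrACA.
    by rewrite -addB6 [in LHS]opprD [X in X - _ = _]addrACA subrr add0r.
  set d := vnorm (z - w); have d0 : 0 <= d by exact: vnorm_ge0.
  have c2gt0 : 0 < 2 * c by exact: mulr_gt0.
  have cs0 : 0 <= 2 * c * s by exact/ltW/mulr_gt0.
  have cd0 : 0 <= 2 * c * d by apply: mulr_ge0 => //; exact: ltW.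
  have b1 : vnorm ((u p1 z - u p1 w) \o u p2 z : E)%VF <= C4 * (2 * c * d) * (2 * c * s).
    apply: le_trans (C4P _ _) _; rewrite ler_pM ?mulr_ge0 ?vnorm_ge0 ?(ltW C40) ?u_le//.
    by rewrite ler_pM2l// u_lip.
  have b2 : vnorm (u p1 w \o (u p2 z - u p2 w) : E)%VF <= C4 * (2 * c * s) * (2 * c * d).
    apply: le_trans (C4P _ _) _; rewrite ler_pM ?mulr_ge0 ?vnorm_ge0 ?(ltW C40) ?u_lip//.
    by rewrite ler_pM2l// u_le.
  apply: le_trans (_ : C3 * (C6 * c ^+ 2 * s * d + C6 * c ^+ 2 * s * d +
     (C4 * (2 * c * d) * (2 * c * s) + C4 * (2 * c * s) * (2 * c * d))) <= _).
    rewrite ler_pM2l//; apply: le_trans (@vnormD R E _ _) (lerD _ _).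
      by apply: le_trans (@vnormD R E _ _) (lerD _ _); exact: strict.
    exact: le_trans (@vnormD R E _ _) (lerD b1 b2).
  rewrite (_ : _ * _ = K * s * d); last by rewrite /K; ring.
  by rewrite ler_wpM2r.
exists (s / 2) => [|v vd]; first exact: divr_gt0.
(* A fixed point solves [P (f z) = v]. Since [T 0 = v - P 1] has norm below [s / 2] and [T] halves
   distances, the ball of radius [s] is preserved. *)
pose T (z : gr) : gr := z - (P (f z) : gr) + (v : gr).
have f0 : f 0 = \1%VF by rewrite /f !u0 !addr0 comp_lfun1l.
have TB (z w : gr) : T z - T w = z - w - (P (f z - f w) : gr).
  have -> : (P (f z - f w) : gr) = (P (f z) : gr) - (P (f w) : gr) := raddfB P _ _.
  by rewrite /T opprD addrACA subrr addr0 opprD addrACA -opprD.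
have Tc (z w : gr) : vnorm z <= s -> vnorm w <= s -> vnorm (T z - T w) <= 2^-1 * vnorm (z - w).
  by move=> zs ws; rewrite TB; exact: fB.
have [|z zs Tz] := contraction_fixpoint (ltW s0) _ Tc.
  move=> z zs; rewrite -[T z](subrK (T 0)); apply: le_trans (vnormD _ _) _.
  have -> : s = 2^-1 * s + 2^-1 * s by field.
  apply: lerD; last first.
    by rewrite [leRHS]mulrC /T f0 sub0r addrC; exact: ltW.
  have := Tc z 0 zs; rewrite vnorm0 subr0 => /(_ (ltW s0))/le_trans; apply.
  by rewrite ler_pM2l// invr_gt0.
exists (p1 z : g), (p2 z : g); split.
- exact: memv_pi1.
- exact: memv_pi2.
- rewrite !exE -/(f z); apply/esym/eqP; rewrite -subr_eq0; apply/eqP.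
  by apply: (@addrI gr z); rewrite addr0 -[RHS]Tz /T addrAC -addrA.
- by rewrite !exE; exact: le_lt_trans (fM _ zs) sM.
Qed.

End LocalInverse.

(** * Orbits of transversal subalgebras *)

Section PolynomialForms.
Variables (R : realType) (n : nat).
Local Notation V := 'rV[R]_n.

Lemma polfun_linear (phi : V -> R) : linear (phi : V -> R^o) -> polfun 1 phi.
Proof.
move=> lin; pose phiL := HB.pack_for {linear V -> R^o} (phi : V -> R^o)
  (GRing.isLinear.Build R V R^o *:%R (phi : V -> R^o) lin).
have -> : phi = fun v => \sum_i phi (delta_mx 0 i) * v 0 i.
  apply/funext => v; rewrite -[phi]/(phiL : V -> R^o) {1}(row_sum_delta v) linear_sum.
  by apply: eq_bigr => i _; rewrite linearZ mulrC.
by apply: polfun_sum => i _; apply: polfunZ; exact: polfun_coord.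
Qed.

Lemma polfun_bilinear (phi : V -> V -> R) :
  (forall v, linear (phi v : V -> R^o)) -> (forall v, linear (phi^~ v : V -> R^o)) ->
  polfun 2 (fun v => phi v v).
Proof.
move=> linr linl.
pose phiL v := HB.pack_for {linear V -> R^o} (phi^~ v : V -> R^o)
  (GRing.isLinear.Build R V R^o *:%R (phi^~ v : V -> R^o) (linl v)).
have -> : (fun v => phi v v) = fun v => \sum_i v 0 i * phi (delta_mx 0 i) v.
  apply/funext => v; rewrite -[phi v v]/(phiL v v) {2}(row_sum_delta v) linear_sum.
  by apply: eq_bigr => i _; rewrite linearZ.
apply: polfun_sum => i _; apply: (@polfun_mul _ _ 1 1); first exact: polfun_coord.
exact: polfun_linear.
Qed.

End PolynomialForms.

Section AdjointGroup.
Variables (R : realType) (g : lieAlgType R[i]).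
Local Notation gr := (realification R g).
Implicit Types (a b c f : 'End(g)) (U W : {vspace gr}).

Definition lie_hom f := forall x y, f (lie x y) = lie (f x) (f y).

Lemma real_lfun_comp f h : real_lfun (f \o h)%VF = (real_lfun f \o real_lfun h)%VF.
Proof.
by apply/lfunP => x; rewrite comp_lfunE !real_lfunE comp_lfunE.
Qed.

Lemma real_lfun1 : real_lfun (\1%VF : 'End(g)) = \1%VF.
Proof. by apply/lfunP => x; rewrite real_lfunE !id_lfunE. Qed.

Lemma lker_real_lfun f : lker f == 0%VS -> lker (real_lfun f) == 0%VS.
Proof.
move/lker0P => f_inj; apply/lker0P => x y; rewrite !real_lfunE.
exact: f_inj.
Qed.

Lemma real_img_comp f h W :
  (real_lfun (f \o h)%VF @: W)%VS = (real_lfun f @: (real_lfun h @: W))%VS.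
Proof. by rewrite real_lfun_comp limg_comp. Qed.

Lemma real_img_inv f W : lker f == 0%VS ->
  (real_lfun (f^-1)%VF @: (real_lfun f @: W))%VS = W.
Proof.
move=> f0; rewrite -real_img_comp (_ : (f^-1 \o f)%VF = \1%VF).
  by rewrite real_lfun1 lim1g.
by apply/lfunP => x; rewrite comp_lfunE lker0_lfunK// id_lfunE.
Qed.

Lemma real_img_stable f U : lker f == 0%VS ->
  (forall x, x \in U -> (f x : gr) \in U) -> (real_lfun f @: U)%VS = U.
Proof.
move=> /lker_real_lfun/eqP f0 fU; apply/eqP.
rewrite eqEdim limg_dim_eq ?f0 ?capv0// leqnn andbT.
by apply/subvP => _ /memv_imgP[x xU ->]; rewrite real_lfunE fU.
Qed.

Lemma lie_hom_comp a b : lie_hom a -> lie_hom b -> lie_hom (a \o b)%VF.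
Proof. by move=> ah bh x y; rewrite !comp_lfunE bh ah. Qed.

Lemma lie_hom_inv a : lker a == 0%VS -> lie_hom a -> lie_hom (a^-1)%VF.
Proof.
move=> a0 ah x y; apply: (lker0P a0).
by rewrite ah !lker0_lfunVK.
Qed.

Lemma exp_ad_hom (x : g) : lie_hom (lfun_exp (ad x)).
Proof.
apply: exp_derivation_lie => y z; rewrite !adE.
by rewrite -[lie x (lie y z)]adE -[lie (lie x y) z]adE ad_lie add_lfunE opp_lfunE !comp_lfunE !adE subrK.
Qed.

Lemma real_img_exp_ad (x : g) U : lker (lfun_exp (ad x)) == 0%VS ->
  (forall y : gr, y \in U -> (lie (x : gr) y) \in U) ->
  (real_lfun (lfun_exp (ad x)) @: U)%VS = U.
Proof.
move=> e0 xU; apply: real_img_stable => //; apply: exp_stable => y yU.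
by rewrite adE xU.
Qed.

Lemma im_killing_nondeg gR W : real_manin_triple gR W ->
  forall x : g, (forall y, killing x y = 0) -> x = 0.
Proof.
move=> mt x x0; apply: (manin_nondeg mt) => y.
by rewrite /im_killing x0.
Qed.

Hypothesis g_simple : simple_lie g.

Lemma simple_nonzero : exists x : g, x != 0.
Proof.
have [[x [y xy]] _] := g_simple; exists x; apply/eqP => x0; apply: xy.
by rewrite -adE x0 [ad 0]linear0 lfunE.
Qed.

Lemma simple_hom_injective f x : lie_hom f -> f x != 0 -> lker f == 0%VS.
Proof.
move=> fh fx; have [_ /(_ (lker f))[|->|fT]] := g_simple => //.
  by move=> y z; rewrite !memv_ker fh => /eqP->; rewrite -adE linear0.
by move: fx; rewrite -memv_ker fT memvf.
Qed.

(** Simplicity replaces the inverse [exp (- ad x)]: a homomorphism that is not zero is injective,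
    and this one fixes [x], or any nonzero vector when [x = 0]. *)
Lemma exp_ad_injective (x : g) : lker (lfun_exp (ad x)) == 0%VS.
Proof.
have [z [z0 xz]] : exists z, z != 0 /\ ad x z = 0.
  have [->|x0] := eqVneq x 0; last by exists x; rewrite adE liexx.
  by have [z z0] := simple_nonzero; exists z; rewrite [ad 0]linear0 lfunE.
by apply: (simple_hom_injective (x := z)); [exact: exp_ad_hom|rewrite exp_fixed].
Qed.

(** Both conclusions go through the induction together: in the inverse case, injectivity makes
    [a^-1] a genuine inverse, which the homomorphism property requires. *)
Lemma adjoint_group_hom a : adjoint_group a -> lie_hom a /\ lker a == 0%VS.
Proof.
elim=> {a} [x||a b _ [ah a0] _ [bh b0]|a _ [ah a0]].
- by split; [exact: exp_ad_hom|exact: exp_ad_injective].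
- by split=> [x y|]; [rewrite !id_lfunE|apply/lker0P => x y; rewrite !id_lfunE].
- split; first exact: lie_hom_comp.
  by apply/lker0P => x y; rewrite !comp_lfunE => /(lker0P a0)/(lker0P b0).
- split; first exact: lie_hom_inv.
  apply/lker0P => x y /(congr1 a); by rewrite !lker0_lfunVK.
Qed.

End AdjointGroup.

Lemma manin_triple_proper (F : fieldType) (d : lieAlgType F) (B : d -> d -> F) g1 g2 :
  manin_triple B g1 g2 -> (forall z, z \in g1) -> forall x : d, x = 0.
Proof.
move=> triple g1T x; apply: (manin_nondeg triple) => y.
by have [iso _] := manin_max1 triple; exact: iso.
Qed.

Lemma manin_triple_decomposition (F : fieldType) (d : lieAlgType F) (B : d -> d -> F) g1 g2 :
  manin_triple B g1 g2 -> (g1 :&: g2 = 0)%VS /\ (g1 + g2 = fullv)%VS.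
Proof. by move=> /manin_direct[/directv_addP]. Qed.

Section OrbitRelation.
Variables (R : realType) (g : lieAlgType R[i]).
Local Notation gr := (realification R g).
Local Notation E := (realification R 'End(g)).
Variables (gR W : {vspace gr}).
Implicit Types (a b c f : 'End(g)).
Hypothesis g_simple : simple_lie g.
Hypothesis triple : real_manin_triple gR W.

(** Gauge equivalence of the images of [W], transported to endomorphisms so that openness can be
    tested in the vector space ['End(g)]. *)
Definition same_orbit a b := exists c, [/\ adjoint_group c,
  (real_lfun c @: gR)%VS = gR &
  (real_lfun b @: W)%VS = (real_lfun c @: (real_lfun a @: W))%VS].

Lemma same_orbit_sym a b : same_orbit a b -> same_orbit b a.
Proof.
move=> [c [Gc cgR bE]]; have [_ c0] := adjoint_group_hom g_simple Gc.
exists (c^-1)%VF; split; first exact: adjoint_inv.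
  by rewrite -{1}cgR real_img_inv.
by rewrite bE real_img_inv.
Qed.

Lemma same_orbit_trans a b f : same_orbit a b -> same_orbit b f -> same_orbit a f.
Proof.
move=> [c [Gc cgR bE]] [d [Gd dgR fE]]; exists (d \o c)%VF; split.
- exact: adjoint_mul.
- by rewrite real_img_comp cgR.
- by rewrite fE bE real_img_comp.
Qed.

(** If [a] were zero, [gR] would be everything; being isotropic, it would contradict nondegeneracy.
    Otherwise simplicity applies. Homomorphisms satisfying the transversality condition are thus
    automorphisms. *)
Lemma complement_injective a : lie_hom a ->
  (gR + real_lfun a @: W = fullv)%VS -> lker a == 0%VS.
Proof.
move=> ah agR.
have [[x ax]|a0] := pselect (exists x, a x != 0).
  exact (simple_hom_injective g_simple ah ax).
have [x /eqP x0] := simple_nonzero g_simple; case: x0.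
suff gT (z : gr) : z \in gR by exact (manin_triple_proper triple gT x).
have /memv_addP[u ugR [_ /memv_imgP[w _ ->] ->]] : z \in (gR + real_lfun a @: W)%VS.
  by rewrite agR memvf.
rewrite real_lfunE; have -> : a w = 0.
  by apply/eqP; apply: contra_notT a0 => aw; exists w.
by rewrite (@addr0 gr).
Qed.

(** The homomorphism [b \o a^-1] is near the identity. Surjectivity yields a product of exponentials
    with the same value under [P], and uniqueness identifies the two. The inner factor preserves the
    subalgebra [a(W)], the outer one preserves [gR]. *)
Lemma same_orbit_near a : lie_hom a -> (gR + real_lfun a @: W = fullv)%VS ->
  exists2 r, 0 < r & forall b, lie_hom b -> vnorm (a - b : E) < r -> same_orbit a b.
Proof.
move=> ah agR; have a0 := complement_injective ah agR.
have nd := im_killing_nondeg triple.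
have [P [PE PK]] := ad_projection nd.
have [e e0 Pe] := hom_unique_near1 nd PE.
have [d d0 Pd] := exp_product_surjective_near1 PK agR e0.
have [C3 C30 C3P] := real_P_bounded P; have [C4 C40 C4P] := comp_bounded g.
pose M := C4 * (1 + vnorm (a^-1%VF : E)).
have M0 : 0 < M by rewrite mulr_gt0// ltr_pwDl// vnorm_ge0.
(* [e] is the range of uniqueness; [d / C3] brings [P f] within [d] of [P 1]. Dividing by [M]
   accounts for composition with [a^-1]. *)
pose r := Num.min e (d / C3).
have r0 : 0 < r by rewrite lt_min e0 divr_gt0.
exists (r / M) => [|b bh ab]; first exact: divr_gt0.
pose f := (b \o a^-1)%VF.
have fa : (f \o a)%VF = b.
  by apply/lfunP => x; rewrite !comp_lfunE lker0_lfunK.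
have f1 : vnorm (f - \1%VF : E) < r.
  have -> : f - \1%VF = ((b - a) \o a^-1)%VF.
    rewrite comp_lfunDl comp_lfunNl; congr (_ - _).
    by apply/lfunP => x; rewrite comp_lfunE lker0_lfunVK// id_lfunE.
  apply: le_lt_trans (C4P _ _) _; rewrite [vnorm (b - a : E)]vnormBC.
  move: ab; rewrite ltr_pdivlMr// => /(le_lt_trans _); apply.
  rewrite mulrAC mulrC ler_wpM2l ?vnorm_ge0//; rewrite /M ler_pM2l//.
  by rewrite lerDr.
have [|x [y [xgR yW Pxy xy1]]] := Pd (P f).
  rewrite -[_ - _](raddfB P); apply: le_lt_trans (C3P _) _.
  by rewrite mulrC -ltr_pdivlMr//; apply: lt_le_trans f1 _; rewrite ge_min lexx orbT.
have fE : f = (lfun_exp (ad x) \o lfun_exp (ad y))%VF.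
  apply: Pe => //.
  - exact: lie_hom_comp (lie_hom_inv a0 ah).
  - exact: lie_hom_comp (exp_ad_hom x) (exp_ad_hom y).
  - by apply: lt_le_trans f1 _; rewrite ge_min lexx.
have gR_sub := manin_subalg1 triple; have W_sub := manin_subalg2 triple.
exists (lfun_exp (ad x)); split; first exact: adjoint_exp.
  by apply: real_img_exp_ad => [|z zgR]; [exact: exp_ad_injective|exact: gR_sub].
rewrite -fa fE !real_img_comp; congr (_ @: _)%VS.
apply: real_img_exp_ad => [|_ /memv_imgP[w wW ->]]; first exact: exp_ad_injective.
have /memv_imgP[v vW yE] := yW.
rewrite yE !real_lfunE; have -> : lie (a v : gr) (a w : gr) = a (lie v w) :> gr by rewrite ah.
by rewrite -real_lfunE memv_img// W_sub.
Qed.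

End OrbitRelation.

(** * Polynomial conditions for homomorphisms and transversality *)

Lemma lfun_linear (F : fieldType) (U V : vectType F) (f : 'Hom(U, V)) : linear f.
Proof. exact: linearP. Qed.

Lemma linear_add_comp (F : fieldType) (U : lmodType F) (p q a : U -> U) :
  linear p -> linear q -> linear a -> linear (fun z => p z + a (q z)).
Proof. by move=> lp lq la r x y; rewrite lp lq la scalerDr addrACA. Qed.

Lemma v2r_linearE (R : realType) (U W : vectType R) (f : U -> W) x : linear f ->
  v2r (f x) = v2r x *m \matrix_(i, j) v2r (f (r2v (delta_mx 0 i))) 0 j.
Proof.
move=> lf; pose fL := HB.pack_for {linear U -> W} f
  (GRing.isLinear.Build R U W *:%R f lf).
rewrite -[f x]/(fL x) {1}(r2v_coordE x) linear_sum linear_sum.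
apply/rowP => j; rewrite summxE mxE; apply: eq_bigr => i _.
by rewrite linearZ linearZ !mxE.
Qed.

Lemma polfun_coord_linear (R : realType) n (U : vectType R) (f : 'rV[R]_n -> U) k :
  linear f -> polfun 1 (fun v => v2r (f v) 0 k).
Proof.
by move=> lf; apply: polfun_linear => r v w; rewrite lf linearP !mxE.
Qed.

Lemma polfun_coord_bilinear (R : realType) n (U V W : vectType R)
    (f : U -> V -> W) (p : 'rV[R]_n -> U) (q : 'rV[R]_n -> V) k :
  (forall x, linear (f x)) -> (forall y, linear (f^~ y)) -> linear p -> linear q ->
  polfun 2 (fun v => v2r (f (p v) (q v)) 0 k).
Proof.
move=> fr fl lp lq; apply: (polfun_bilinear (phi := fun v w => v2r (f (p v) (q w)) 0 k)) => z r v w.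
  by rewrite lq fr linearP !mxE.
by rewrite lp fl linearP !mxE.
Qed.

Section PolynomialDescription.
Variables (R : realType) (g : lieAlgType R[i]).
Local Notation gr := (realification R g).
Local Notation E := (realification R 'End(g)).
Local Notation n := (dim E).
Local Notation N := (dim gr).
Variables (gR W : {vspace gr}).

Let e (i : 'I_N) : gr := r2v (delta_mx 0 i).

Lemma bilinear_eq0 (U : vectType R) (f : U -> U -> U) :
  (forall x, linear (f x)) -> (forall y, linear (f^~ y)) ->
  (forall i j, f (r2v (delta_mx 0 i)) (r2v (delta_mx 0 j)) = 0) ->
  forall x y, f x y = 0.
Proof.
move=> fr fl f0 x y.
pose fL z := HB.pack_for {linear U -> U} (f^~ z)
  (GRing.isLinear.Build R U U *:%R (f^~ z) (fl z)).
pose fR z := HB.pack_for {linear U -> U} (f z)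
  (GRing.isLinear.Build R U U *:%R (f z) (fr z)).
rewrite (r2v_coordE x) -[f _ _]/(fL y _) linear_sum big1// => i _.
rewrite linearZ /= (r2v_coordE y) -[f _ _]/(fR _ _) linear_sum big1 ?scaler0// => j _.
by rewrite linearZ /= f0 scaler0.
Qed.

Lemma apply_r2v_linear (z : gr) : linear (fun v : 'rV[R]_n => (r2v v : E) z : gr).
Proof.
have lin : linear (fun a : E => (a : 'End(g)) z : gr).
  by apply: realification_linear => r a b; rewrite add_lfunE scale_lfunE.
by move=> r v w; rewrite linearP; exact: lin.
Qed.

Let hom_defect (a : 'End(g)) (x y : gr) : gr := (a (lie x y) : gr) - (lie (a x : gr) (a y : gr) : gr).

Lemma real_apply_linear (a : 'End(g)) : linear (a : gr -> gr).
Proof. exact: realification_linear (linearP a). Qed.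

(** A sum of squares turns all the identities on a real basis into one real equation. *)
Definition hom_poly (v : 'rV[R]_n) : R :=
  \sum_i \sum_j \sum_k v2r (hom_defect (r2v v) (e i) (e j)) 0 k ^+ 2.

Lemma hom_poly_eq0 v : hom_poly v = 0 <-> lie_hom (r2v v : E).
Proof.
split=> [v0|ah]; last first.
  rewrite /hom_poly big1// => i _; rewrite big1// => j _; rewrite big1// => k _.
  rewrite (_ : hom_defect _ _ _ = 0) ?linear0 ?mxE ?expr0n//.
  by rewrite /hom_defect; apply/eqP; rewrite subr_eq0; apply/eqP; exact: ah.
have sq0 i j k : v2r (hom_defect (r2v v) (e i) (e j)) 0 k = 0.
  apply/eqP; rewrite -sqrf_eq0; apply/eqP.
  have s1 i1 j1 : 0 <= \sum_k v2r (hom_defect (r2v v) (e i1) (e j1)) 0 k ^+ 2.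
    by apply: sumr_ge0 => k1 _; exact: sqr_ge0.
  have s2 i1 : 0 <= \sum_j1 \sum_k v2r (hom_defect (r2v v) (e i1) (e j1)) 0 k ^+ 2.
    by apply: sumr_ge0 => j1 _; exact: s1.
  have t1 : \sum_j1 \sum_k v2r (hom_defect (r2v v) (e i) (e j1)) 0 k ^+ 2 = 0.
    exact: (psumr_eq0P (fun i1 _ => s2 i1) v0).
  have t2 : \sum_k v2r (hom_defect (r2v v) (e i) (e j)) 0 k ^+ 2 = 0.
    exact: (psumr_eq0P (fun j1 _ => s1 i j1) t1).
  exact: (psumr_eq0P (fun k1 _ => sqr_ge0 _) t2).
move=> x y; apply/eqP; rewrite -subr_eq0; apply/eqP.
pose a : 'End(g) := r2v v.
have fr (z : gr) : linear (hom_defect a z).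
  move=> r u w; rewrite /hom_defect.
  rewrite [lie z _](real_lie_linearr z) [a (_ + _)](real_apply_linear a).
  rewrite [a (_ + _) in X in _ - X](real_apply_linear a).
  rewrite [lie _ (_ + _)](real_lie_linearr (a z)).
  by rewrite scalerBr opprD addrACA.
have fl (z : gr) : linear (hom_defect a ^~ z).
  move=> r u w; rewrite /hom_defect.
  rewrite [lie _ z](real_lie_linearl z) [a (_ + _)](real_apply_linear a).
  rewrite [a (_ + _) in X in _ - X](real_apply_linear a).
  rewrite [lie (_ + _) _](real_lie_linearl (a z)).
  by rewrite scalerBr opprD addrACA.
apply: (bilinear_eq0 fr fl) => i j.
apply: (can_inj v2rK); apply/rowP => k; rewrite linear0 mxE.
exact: sq0.
Qed.

Lemma polfun_hom_poly : polfun 4 hom_poly.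
Proof.
apply: polfun_sum => i _; apply: polfun_sum => j _; apply: polfun_sum => k _.
apply: (polfunX 2 (d := 2)).
have -> : (fun v : 'rV[R]_n => v2r (hom_defect (r2v v) (e i) (e j)) 0 k) =
    fun v => v2r ((r2v v : E) (lie (e i) (e j)) : gr) 0 k
      - v2r (lie ((r2v v : E) (e i) : gr) ((r2v v : E) (e j) : gr)) 0 k.
  by apply/funext => v; rewrite /hom_defect linearB !mxE.
apply: polfunB.
  apply: (@polfun_le _ _ 1) => //; apply: polfun_coord_linear.
  exact: apply_r2v_linear.
exact: (polfun_coord_bilinear _ (@real_lie_linearr _ g) (@real_lie_linearl _ g)
  (apply_r2v_linear (e i)) (apply_r2v_linear (e j))).
Qed.

(** For complementary [gR] and [W] this is the identity on [gR] and the endomorphism on [W]. Its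
    image is then the sum tested for transversality, so a determinant decides whether that sum is
    everything. *)
Let move_W (v : 'rV[R]_n) (z : gr) : gr :=
  daddv_pi gR W z + ((r2v v : E) (daddv_pi W gR z : gr) : gr).

Definition transversality_poly (v : 'rV[R]_n) : R :=
  \det (\matrix_(i, j) v2r (move_W v (e i)) 0 j).

Lemma polfun_transversality : exists d, polfun d transversality_poly.
Proof.
exists (N * 1)%N; apply: polfun_det => i j.
have -> : (fun v : 'rV[R]_n => (\matrix_(i, j) v2r (move_W v (e i)) 0 j) i j) =
    fun v => v2r (daddv_pi gR W (e i)) 0 j
      + v2r ((r2v v : E) (daddv_pi W gR (e i) : gr) : gr) 0 j.
  by apply/funext => v; rewrite mxE linearD !mxE.
apply: polfun_add; first exact: polfun_const.
by apply: polfun_coord_linear; exact: apply_r2v_linear.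
Qed.

Lemma transversality_poly_neq0 v : (gR :&: W = 0)%VS ->
  transversality_poly v != 0 <-> (gR + real_lfun (r2v v : E) @: W = fullv)%VS.
Proof.
move=> gRW; set a : 'End(g) := r2v v; set M := \matrix_(i, j) v2r (move_W v (e i)) 0 j.
have T_linear : linear (move_W v).
  exact (linear_add_comp (lfun_linear (daddv_pi gR W)) (lfun_linear (daddv_pi W gR))
    (real_apply_linear a)).
have TE (x : gr) : v2r (move_W v x) = v2r x *m M by exact: v2r_linearE.
have -> : (transversality_poly v != 0) = (M \in unitmx).
  by rewrite unitmxE unitfE.
split=> [uM|aT].
  apply/eqP; rewrite eqEsubv subvf; apply/subvP => x _.
  have -> : x = move_W v (r2v (v2r x *m invmx M)).
    by apply: (can_inj v2rK); rewrite TE r2vK mulmxKV.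
  apply: memv_add; first exact: memv_pi.
  by rewrite -real_lfunE memv_img// memv_pi.
have T_surj (x : gr) : exists z, move_W v z = x.
  have /memv_addP[u uR [_ /memv_imgP[w wW ->] ->]] : x \in (gR + real_lfun a @: W)%VS.
    by rewrite aT memvf.
  have WgR : (W :&: gR = 0)%VS by rewrite capvC.
  have gw0 : daddv_pi gR W w = 0.
    apply: (addIr (daddv_pi W gR w)); rewrite add0r daddv_pi_add//.
      by rewrite daddv_pi_id.
    exact: subvP (addvSr _ _) _ wW.
  have wu0 : daddv_pi W gR u = 0.
    apply: (addIr (daddv_pi gR W u)); rewrite add0r daddv_pi_add//.
      by rewrite daddv_pi_id.
    exact: subvP (addvSr _ _) _ uR.
  exists (u + w); rewrite /move_W real_lfunE !linearD /= gw0 wu0.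
  by rewrite !daddv_pi_id// addr0 linear0 add0r.
have /choice[z zP] i := T_surj (e i).
apply: (@mulmx1_unit _ _ (\matrix_i v2r (z i)) _ _).2.
by apply/row_matrixP => i; rewrite row_mul rowK -TE zP r2vK row1.
Qed.
End PolynomialDescription.

(** * Finiteness of the gauge classes in a weak class *)

Theorem corollary4p15 (R : realType) (g : lieAlgType R[i])
    (gR : {vspace realification R g}) :
  simple_lie g -> real_form gR ->
  forall A : set {vspace realification R g}, is_weak_class gR A ->
  exists C : set (set {vspace realification R g}),
    [/\ finite_set C, (forall c, C c -> is_gauge_class gR c)
      & A = \bigcup_(c in C) c].
Proof.
move=> g_simple _ A [W tW AE].
pose gauge_class W' := [set W'' | real_manin_triple gR W'' /\ gauge_equiv gR W' W''].
have gauge_sym W1 W2 : gauge_equiv gR W1 W2 -> gauge_equiv gR W2 W1.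
  move=> [c [Gc -> cgR]]; have [_ c0] := adjoint_group_hom g_simple Gc.
  exists (c^-1)%VF; split; [exact: adjoint_inv|by rewrite real_img_inv|].
  by rewrite -{1}cgR real_img_inv.
have gauge_trans W1 W2 W3 :
    gauge_equiv gR W1 W2 -> gauge_equiv gR W2 W3 -> gauge_equiv gR W1 W3.
  move=> [c [Gc -> cgR]] [d [Gd -> dgR]]; exists (d \o c)%VF; split.
  - exact: adjoint_mul.
  - by rewrite real_img_comp.
  - by rewrite real_img_comp cgR.
have A_manin W' : A W' -> real_manin_triple gR W' by rewrite AE => -[].
exists (gauge_class @` A); split=> [|_ [W' /A_manin mW' <-]|]; last 2 first.
- by exists W'.
- apply/seteqP; split=> [W' AW'|W'' [_ [W' AW' <-] [mW'' [c [Gc W''E _]]]]].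
    exists (gauge_class W'); first by exists W'.
    split; first exact: A_manin.
    exists \1%VF; split; [exact: adjoint_one| |]; by rewrite real_lfun1 lim1g.
  rewrite AE; split=> //; move: AW'; rewrite AE W''E => -[_ [a Ga ->]].
  by exists (c \o a)%VF; [exact: adjoint_mul|rewrite real_img_comp].
pose Endr := realification R 'End(g).
pose E (v w : 'rV[R]_(dim Endr)) := same_orbit gR W (r2v v : Endr) (r2v w : Endr).
have [gRW0 _] := manin_triple_decomposition tW.
have [d pf] := polfun_transversality gR W.
have [|v w|u v w|v hv fv|N NP] := @finitely_many_open_classes R _
  (@hom_poly R g) (transversality_poly gR W) 4 d E _ pf.
- exact: polfun_hom_poly.
- exact: same_orbit_sym.
- exact: same_orbit_trans.
- have [r r0 rP] := same_orbit_near g_simple tW ((hom_poly_eq0 v).1 hv)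
    ((transversality_poly_neq0 v gRW0).1 fv).
  exists r => // w hw _ vw; apply: rP; first exact/hom_poly_eq0.
  rewrite /vnorm (_ : v2r _ = v - w)// -[LHS]/(v2r ((r2v v : Endr) - r2v w)).
  by rewrite -linearB r2vK.
(* The bound [N] is independent of the classes, so a finite family of more than [N] distinct ones is
   already contradictory. Each is represented by some [a(W)] with [a] in the adjoint group, and the
   decomposition in its Manin triple is the transversality of [a]. *)
apply: contrapT => /(infinite_set_fset N.+1)[B BC]; apply/negP; rewrite -leqNgt.
pose c j := nth set0 (enum_fset B) j.
have /choice[a aP] (j : 'I_#|` B|) : exists a : 'End(g), [/\ adjoint_group a,
    real_manin_triple gR (real_lfun a @: W)%VS &
    gauge_class (real_lfun a @: W)%VS = c j].
  have /BC[W' AW' <-] : [set` B] (c j) by apply: mem_nth.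
  by move: AW'; rewrite AE => -[mW' [a Ga W'E]]; exists a; rewrite -W'E.
apply: (NP _ (fun j => v2r (a j : realification R 'End(g)))) => [j|j|j l].
- by apply/hom_poly_eq0; rewrite v2rK; have [/(adjoint_group_hom g_simple)[]] := aP j.
- apply/(transversality_poly_neq0 _ gRW0); rewrite v2rK.
  by have [_ /manin_triple_decomposition[]] := aP j.
rewrite /E !v2rK => -[b [Gb bgR alE]].
have ajl : gauge_equiv gR (real_lfun (a j) @: W)%VS (real_lfun (a l) @: W)%VS by exists b.
have cjl : c j = c l.
  have [_ _ <-] := aP j; have [_ _ <-] := aP l.
  apply/seteqP; split=> W' [mW' eW']; split=> //.
    exact: gauge_trans (gauge_sym _ _ ajl) eW'.
  exact: gauge_trans ajl eW'.
apply/val_inj/eqP; rewrite -(nth_uniq set0 (ltn_ord j) (ltn_ord l)) ?fset_uniq//.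
exact/eqP.
Qed.
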